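(* Let $\mathcal H$ be a complex Hilbert space, $T\in\boldsymbol B(\mathcal H)$ a positive injective operator, and $\alpha,\beta$ distinct positive real numbers. Let $F:\mathcal B(\mathbb R_+)\to\boldsymbol B(\mathcal H)$ be a positive operator valued measure with compact support. Then the following are equivalent: (i) $F$ is the spectral measure of $T$; (ii) $T^p=\int_{\mathbb R_+}x^p\,F(dx)$ for $p=\alpha$ and $p=\beta$, and $F(\mathbb R_+)\le I$.
   Context: $\mathbb R_+=[0,\infty)$, $\mathcal B(\mathbb R_+)$ its Borel $\sigma$-algebra. A positive operator valued (POV) measure is a map $F:\mathcal B(\mathbb R_+)\to\boldsymbol B(\mathcal H)$ such that $\langle F(\cdot)h,h\rangle$ is a (positive, countably additive) measure for every $h\in\mathcal H$. For a suitable Borel function $f$, $\int f\,dF$ is the unique bounded operator with $\langle(\int f\,dF)h,h\rangle=\int f(x)\langle F(dx)h,h\rangle$ for all $h$. Compact support means $F(\mathbb R_+\setminus K)=0$ for some compact $K$. *)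

(* Defs.v *)
From HB Require Import structures.
From mathcomp Require Import all_boot all_order all_algebra.
From mathcomp Require Import all_classical all_reals all_analysis.
From mathcomp Require Import complex.
Set Implicit Arguments. Unset Strict Implicit. Unset Printing Implicit Defensive.
Import Order.TTheory GRing.Theory Num.Theory numFieldNormedType.Exports.
Local Open Scope classical_set_scope.
Local Open Scope ring_scope.
Local Open Scope complex_scope.

Section HilbertDefs.
Variable R : realType.
Local Notation C := R[i].
Variable H : lmodType C.
Variable ip : H -> H -> C.

Definition is_inner_product : Prop :=
  [/\ (forall (a : C) (u v w : H), ip (a *: u + v) w = a * ip u w + ip v w),
      (forall u v : H, ip v u = conjc (ip u v)),
      (forall u : H, 0 <= ip u u) &
      (forall u : H, ip u u = 0 -> u = 0)].

Definition hnorm (u : H) : R := Num.sqrt (complex.Re (ip u u)).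

Definition hcomplete : Prop :=
  forall u : nat -> H,
    (forall e : R, 0 < e -> exists N : nat, forall m n : nat,
        (N <= m)%N -> (N <= n)%N -> hnorm (u m - u n) < e) ->
    exists v : H, forall e : R, 0 < e -> exists N : nat, forall n : nat,
        (N <= n)%N -> hnorm (u n - v) < e.

Definition is_hilbert : Prop := is_inner_product /\ hcomplete.

Definition is_bop (T : H -> H) : Prop :=
  (forall (a : C) (u v : H), T (a *: u + v) = a *: T u + T v) /\
  exists M : R, forall u : H, hnorm (T u) <= M * hnorm u.

Definition positive_op (T : H -> H) : Prop := forall h : H, 0 <= ip (T h) h.

Definition Rplus : set R := `[0, +oo[%classic.

(* Operator-valued set functions are given on subsets of R; only the Borel
   subsets of R_+ (measurable A with A `<=` Rplus) matter. *)

Definition qmeasure (F : set R -> H -> H) (h : H)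
    (mu : {measure set R -> \bar R}) : Prop :=
  forall A : set R, measurable A -> A `<=` Rplus ->
    complex.Im (ip (F A h) h) = 0 /\ mu A = (complex.Re (ip (F A h) h))%:E.

Definition is_povm (F : set R -> H -> H) : Prop :=
  (forall A : set R, measurable A -> A `<=` Rplus -> is_bop (F A)) /\
  forall h : H, exists mu : {measure set R -> \bar R}, qmeasure F h mu.

Definition compact_support (F : set R -> H -> H) : Prop :=
  exists K : set R, [/\ compact K, K `<=` Rplus &
    forall h : H, F (Rplus `\` K) h = 0].

Definition is_opintegral (F : set R -> H -> H) (f : R -> R) (S : H -> H)
  : Prop :=
  is_bop S /\
  forall (h : H) (mu : {measure set R -> \bar R}), qmeasure F h mu ->
    mu.-integrable Rplus (fun x => (f x)%:E) /\
    ip (S h) h = (fine (\int[mu]_(x in Rplus) (f x)%:E))%:C.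

Definition is_pvm (E : set R -> H -> H) : Prop :=
  [/\ is_povm E,
      (forall A : set R, measurable A -> A `<=` Rplus ->
         (forall h : H, E A (E A h) = E A h) /\
         (forall u v : H, ip (E A u) v = ip u (E A v))) &
      (forall h : H, E Rplus h = h)].

Definition spectral_measure_of (T : H -> H) (E : set R -> H -> H) : Prop :=
  is_pvm E /\ is_opintegral E id T.

Definition is_oppow (T : H -> H) (p : R) (S : H -> H) : Prop :=
  exists E : set R -> H -> H,
    spectral_measure_of T E /\ is_opintegral E (fun x => x `^ p) S.

End HilbertDefs.

(* Main.v *)
Require Import Defs.
From HB Require Import structures.
From mathcomp Require Import all_boot all_order all_algebra.
From mathcomp Require Import all_classical all_reals all_analysis.
From mathcomp Require Import measurable_realfun.
From mathcomp Require Import complex ring lra.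
Set Implicit Arguments. Unset Strict Implicit. Unset Printing Implicit Defensive.
Import Order.TTheory GRing.Theory Num.Theory numFieldNormedType.Exports.
Local Open Scope classical_set_scope.
Local Open Scope ring_scope.

(* Let E be the spectral measure of T and al < be. For t > 0 the function
   psi_t x = al x^be - be t^(be - al) x^al + (be - al) t^be is nonnegative on
   R_+ and vanishes only at t. Since F and E have the same al-th and be-th
   moments and F(R_+) <= I, for every vector h
     int psi_t d<F h, h> + (be - al) t^be (|h|^2 - <F(R_+) h, h>)
       = int psi_t d<E h, h>.
   If h lies in the range of E(J) with t in a short interval J, the right side
   is O(|J|^2) |h|^2. So a positive form b dominated by the left side (the mass
   defect of F, or <F(A) h, h> with A away from J) is O(|J|^2) |h|^2 there.
   Cutting an interval into n pieces multiplies b by at most n while each piece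
   contributes O(n^-2), hence b vanishes: F(R_+) = I because E({0}) = 0, and
   F(A) E(B) = 0 for disjoint intervals A and B. This forces F = E.
   That both powers of T may be computed with the same E is the uniqueness of
   the spectral measure, which follows from the same orthogonality, obtained
   this time by comparing the growth of T^n on the ranges of E([0, a]) and
   E'([d, oo)), a < d. *)

(** * Positive forms and the real inner product *)

(** Only real scalars and real values are asked for. This covers at once the real part of the inner
    product, <F(A) u, v>, the mass defect of [F] and <T u, v>. *)
Definition psd_form (R : realType) (H : lmodType R[i]) (b : H -> H -> R) : Prop :=
  [/\ (forall u v, b u v = b v u),
      (forall u v w, b (u + v) w = b u w + b v w),
      (forall (a : R) u v, b (real_complex R a *: u) v = a * b u v) &
      (forall u, 0 <= b u u)].

Section PsdForms.
Variables (R : realType) (H : lmodType R[i]) (b : H -> H -> R).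
Hypothesis psd_b : psd_form b.

Lemma psdC u v : b u v = b v u. Proof. by case: psd_b. Qed.
Lemma psdDl u v w : b (u + v) w = b u w + b v w. Proof. by case: psd_b. Qed.
Lemma psdZl a u v : b (real_complex R a *: u) v = a * b u v.
Proof. by case: psd_b. Qed.
Lemma psd_ge0 u : 0 <= b u u. Proof. by case: psd_b. Qed.

Lemma psdDr u v w : b u (v + w) = b u v + b u w.
Proof. by rewrite psdC psdDl !(psdC _ u). Qed.

Lemma psdZr a u v : b u (real_complex R a *: v) = a * b u v.
Proof. by rewrite psdC psdZl (psdC _ u). Qed.

Lemma psdNl u v : b (- u) v = - b u v.
Proof. by have := psdZl (-1) u v; rewrite rmorphN1 scaleN1r mulN1r. Qed.

Lemma psdNr u v : b u (- v) = - b u v.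
Proof. by rewrite psdC psdNl (psdC _ u). Qed.

Lemma psd0l v : b 0 v = 0.
Proof. by have := psdDl 0 0 v; rewrite addr0; lra. Qed.

Lemma psdD u v : b (u + v) (u + v) = b u u + 2 * b u v + b v v.
Proof. by rewrite psdDl !psdDr (psdC v u); ring. Qed.

Lemma psdB u v : b (u - v) (u - v) = b u u - 2 * b u v + b v v.
Proof. by rewrite psdD !psdNr psdNl; ring. Qed.

Lemma psd_cs u v : b u v ^+ 2 <= b u u * b v v.
Proof.
have key a c : 0 <= a ^+ 2 * b u u - 2 * (a * c) * b u v + c ^+ 2 * b v v.
  have := psd_ge0 (real_complex R a *: u - real_complex R c *: v).
  by rewrite psdB !psdZl !psdZr; congr (_ <= _); ring.
have [v0|vn0] := eqVneq (b v v) 0.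
  have [w0|wn0] := eqVneq (b u v) 0; first by rewrite v0 w0 mulr0 expr0n.
  (* When [b v v = 0] the expression in [key] is affine in the second coefficient; this choice makes
     it equal to -1, a contradiction. *)
  have := key 1 ((b u u + 1) / (2 * b u v)); rewrite v0.
  have -> : 2 * (1 * ((b u u + 1) / (2 * b u v))) * b u v = b u u + 1.
    by field.
  by lra.
have vpos : 0 < b v v by rewrite lt_neqAle eq_sym vn0 psd_ge0.
(* These coefficients minimize the quadratic, up to scaling, and leave [b v v] times the
   discriminant gap. *)
have := key (b v v) (b u v).
have -> : b v v ^+ 2 * b u u - 2 * (b v v * b u v) * b u v + b u v ^+ 2 * b v v
  = b v v * (b u u * b v v - b u v ^+ 2) by ring.
by rewrite pmulr_rge0// subr_ge0.
Qed.

Lemma psd_null u v : b u u = 0 -> b u v = 0.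
Proof.
move=> u0; have := psd_cs u v; rewrite u0 mul0r => h.
by apply/eqP; rewrite -sqrf_eq0; apply/eqP/le_anti; rewrite h sqr_ge0.
Qed.

Lemma psd_le2 u v : b (u + v) (u + v) <= 2 * (b u u + b v v).
Proof. by have := psd_ge0 (u - v); rewrite psdB psdD; lra. Qed.

Lemma psd_suml (n : nat) (x : 'I_n -> H) v :
  b (\sum_(i < n) x i) v = \sum_(i < n) b (x i) v.
Proof.
elim: n x => [|n IH] x; first by rewrite !big_ord0 psd0l.
by rewrite !big_ord_recr/= psdDl IH.
Qed.

(** Each cross term obeys 2 b(x, w) <= b(x, x) + b(w, w). This is the factor n paid for cutting an
    interval into n pieces. *)
Lemma psd_sum_le (n : nat) (x : 'I_n -> H) :
  b (\sum_(i < n) x i) (\sum_(i < n) x i) <= n%:R * \sum_(i < n) b (x i) (x i).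
Proof.
elim: n x => [|n IH] x; first by rewrite !big_ord0 psd0l mul0r.
set s := \sum_(i < n) x (widen_ord (leqnSn n) i).
set w := x ord_max.
have cross : 2 * b s w <=
    \sum_(i < n) b (x (widen_ord (leqnSn n) i)) (x (widen_ord (leqnSn n) i))
    + n%:R * b w w.
  have -> : n%:R * b w w = \sum_(i < n) b w w.
    by rewrite sumr_const card_ord mulr_natl.
  rewrite /s psd_suml mulr_sumr -big_split/=; apply: ler_sum => i _.
  by have := psd_ge0 (x (widen_ord (leqnSn n) i) - w); rewrite psdB; lra.
rewrite !big_ord_recr/= -/s -/w psdD -natr1.
by move: (IH (fun i => x (widen_ord (leqnSn n) i))) cross; rewrite -/s; lra.
Qed.

End PsdForms.

(** * The real part of the inner product *)

Section RealInnerProduct.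
Variables (R : realType) (H : lmodType R[i]) (ip : H -> H -> R[i]).
Hypothesis ipP : is_inner_product ip.

Definition re_ip (u v : H) : R := complex.Re (ip u v).
Local Notation rip := re_ip.

Lemma rip_psd : psd_form rip.
Proof.
case: ipP => lin sym pos _; split => [u v|u v w|a u v|u]; rewrite /re_ip.
- by rewrite sym; case: (ip _ _).
- by have := lin 1 u v w; rewrite scale1r mul1r => ->; rewrite raddfD.
- have l0 : ip 0 v = 0.
    have := lin 1 0 0 v; rewrite scale1r mul1r addr0 => /eqP.
    by rewrite -subr_eq0 opprD addNKr oppr_eq0 => /eqP.
  have := lin (real_complex R a) u 0 v; rewrite addr0 l0 addr0 => ->.
  by case: (ip u v) => x y /=; rewrite mul0r subr0.
- by have := pos u; rewrite lecE => /andP[].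
Qed.

Lemma rip_eq0 u : rip u u = 0 -> u = 0.
Proof.
case: ipP => _ sym _ def ru; apply: def.
have := sym u u; move: ru; rewrite /re_ip.
by case: (ip u u) => x y /= -> [] y0; congr Complex; lra.
Qed.

Lemma rip_ext u v : (forall w, rip u w = rip v w) -> u = v.
Proof.
move=> e; apply/subr0_eq/rip_eq0.
by rewrite psdDl ?e -?psdDl ?subrr ?psd0l//; exact: rip_psd.
Qed.

Lemma hnormE u : hnorm ip u = Num.sqrt (rip u u). Proof. by []. Qed.

Section Operators.
Variable L : H -> H.
Hypothesis linL : forall (a : R[i]) (u v : H), L (a *: u + v) = a *: L u + L v.

Lemma linop0 : L 0 = 0.
Proof.
have := linL 1 0 0; rewrite scaler0 addr0 scale1r => /eqP.
by rewrite -subr_eq0 opprD addNKr oppr_eq0 => /eqP.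
Qed.
Lemma linopD u v : L (u + v) = L u + L v.
Proof. by have := linL 1 u v; rewrite !scale1r. Qed.
Lemma linopZ a u : L (a *: u) = a *: L u.
Proof. by have := linL a u 0; rewrite !addr0 linop0 addr0. Qed.
Lemma linopN u : L (- u) = - L u.
Proof. by rewrite -scaleN1r linopZ scaleN1r. Qed.
Lemma linopB u v : L (u - v) = L u - L v.
Proof. by rewrite linopD linopN. Qed.

(* Realness of [<L h, h>] is tested on [u + v] and on [u + i v]. *)
Lemma linop_sym : (forall h, complex.Im (ip (L h) h) = 0) ->
  forall u v, rip (L u) v = rip u (L v).
Proof.
move=> im0 u v; case: ipP => lin sym _ _.
have ipD x y w : ip (x + y) w = ip x w + ip y w.
  by have := lin 1 x y w; rewrite scale1r mul1r.
have l0 w : ip 0 w = 0.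
  have := lin 1 0 0 w; rewrite scale1r mul1r addr0 => /eqP.
  by rewrite -subr_eq0 opprD addNKr oppr_eq0 => /eqP.
have ipZ a x w : ip (a *: x) w = a * ip x w.
  by have := lin a x 0 w; rewrite !addr0 l0 addr0.
have ipDr x y w : ip w (x + y) = ip w x + ip w y.
  by rewrite (sym (x + y) w) ipD rmorphD/= (sym x w) (sym y w).
have ipZr a x w : ip w (a *: x) = conjc a * ip w x.
  by rewrite (sym (a *: x) w) ipZ rmorphM/= (sym x w).
have e : complex.Im (ip (L u) ('i%C *: v) + ip (L ('i%C *: v)) u) = 0.
  have := im0 (u + 'i%C *: v).
  rewrite linopD ipD !ipDr !raddfD/= im0 (im0 ('i%C *: v)); lra.
move: e; rewrite linopZ ipZ ipZr /re_ip (sym (L v) u).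
case: (ip (L u) v) => p q; case: (ip (L v) u) => r s /= e; lra.
Qed.

Lemma linop_psd : (forall h, complex.Im (ip (L h) h) = 0) ->
  (forall h, 0 <= rip (L h) h) -> psd_form (fun u v => rip (L u) v).
Proof.
move=> im0 pos; split => // [u v|u v w|a u v].
- by rewrite linop_sym// (psdC rip_psd).
- by rewrite linopD (psdDl rip_psd).
- by rewrite linopZ (psdZl rip_psd).
Qed.

End Operators.

(** Polarization: for symmetric operators the values at [h + w] recover the mixed terms. It lifts
    identities between scalar measures to identities between operators. *)
Lemma linop_ext (L M : H -> H) :
  (forall (a : R[i]) (u v : H), L (a *: u + v) = a *: L u + L v) ->
  (forall (a : R[i]) (u v : H), M (a *: u + v) = a *: M u + M v) ->
  (forall u v, rip (L u) v = rip u (L v)) ->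
  (forall u v, rip (M u) v = rip u (M v)) ->
  (forall h, rip (L h) h = rip (M h) h) -> forall h, L h = M h.
Proof.
move=> linL linM sL sM e h; apply: rip_ext => w.
have := e (h + w); rewrite !linopD// !(psdDl rip_psd) !(psdDr rip_psd).
rewrite !e (psdC rip_psd (L w) h) -sL (psdC rip_psd (M w) h) -sM; lra.
Qed.

End RealInnerProduct.

(** * The convexity gap of powers *)

(* Up to the factor [t `^ be], [powdev (x / t)] is the error at [x] of the
   tangent at [t] of [x `^ be] viewed as a convex function of [x `^ al]. *)
Definition powdev (R : realType) (al be z : R) : R :=
  al * (z `^ be - 1) - be * (z `^ al - 1).

Section Powdev.
Variables (R : realType) (al be : R).
Hypotheses (al0 : 0 < al) (albe : al < be).
Let be0 : 0 < be := lt_trans al0 albe.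

(** Young's inequality for z^al and 1, with conjugate exponents be / al and be / (be - al). *)
Lemma powdev_ge0 (z : R) : 0 <= z -> 0 <= powdev al be z.
Proof.
move=> z0; have r0 : 0 < be / al by rewrite divr_gt0.
have q0 : 0 < be / (be - al) by rewrite divr_gt0// subr_gt0.
have e : (be / al)^-1 + (be / (be - al))^-1 = 1.
  by rewrite !invf_div; field; rewrite gt_eqF.
have := @conjugate_powR _ (z `^ al) 1 _ _ (powR_ge0 _ _) ler01 r0 q0 e.
rewrite mulr1 powR1 -powRrM [al * _]mulrC divfK ?gt_eqF// mul1r !invf_div => h.
rewrite /powdev -(ler_pM2r (_ : 0 < be^-1)) ?invr_gt0// mul0r.
have -> : (al * (z `^ be - 1) - be * (z `^ al - 1)) / be =
  z `^ be * (al / be) + (be - al) / be - z `^ al.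
  by field; rewrite gt_eqF.
by rewrite subr_ge0.
Qed.

(** Strictness without derivatives: for z = y^2, A = y^al and B = y^be, [powdev] at z is (B + 1)
    times [powdev] at y, plus be (A - 1)(B - A). *)
Lemma powdev_gt0 (z : R) : 0 <= z -> z != 1 -> 0 < powdev al be z.
Proof.
move=> z0 z1; have [ze0|zn0] := eqVneq z 0.
  by rewrite /powdev ze0 !powR0 ?gt_eqF// sub0r !mulrN1 opprK addrC subr_gt0.
pose y := Num.sqrt z.
have y0 : 0 <= y by exact: sqrtr_ge0.
have zE : z = y * y by rewrite -expr2 sqr_sqrtr.
rewrite /powdev zE !powRM//.
have := powdev_ge0 y0; rewrite /powdev.
have ya0 := powR_ge0 y al; have yb0 := powR_ge0 y be.
(* Both factors have the sign of y - 1. *)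
have key : 0 < (y `^ al - 1) * (y `^ be - y `^ al).
  have yn0 : y != 0 by apply: contra zn0 => /eqP y_eq0; rewrite zE y_eq0 mulr0.
  have yp : 0 < y by rewrite lt_neqAle eq_sym yn0.
  have -> : y `^ be = y `^ al * y `^ (be - al).
    by rewrite -powRD ?subrK ?[al + _]addrC ?subrK// yn0 implybT.
  have yap : 0 < y `^ al by exact: powR_gt0.
  have d0 : 0 < be - al by rewrite subr_gt0.
  rewrite -[X in _ * (_ - X)]mulr1 -mulrBr mulrCA mulr_gt0//.
  have [y1|y1|y1] := ltgtP y 1.
  - have := gt0_ltr_powR al0 y0 (ler01 : 1 \is Num.nneg) y1.
    have := gt0_ltr_powR d0 y0 (ler01 : 1 \is Num.nneg) y1.
    by rewrite !powR1; nra.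
  - have := gt0_ltr_powR al0 (ler01 : 1 \is Num.nneg) y0 y1.
    have := gt0_ltr_powR d0 (ler01 : 1 \is Num.nneg) y0 y1.
    by rewrite !powR1; nra.
  - by move: z1; rewrite zE y1 mulr1 eqxx.
move: (y `^ al) (y `^ be) ya0 yb0 key => A B A0 B0 key h.
have -> : al * (B * B - 1) - be * (A * A - 1) =
  (B + 1) * (al * (B - 1) - be * (A - 1)) + be * ((A - 1) * (B - A)) by ring.
have B1 : 0 <= B + 1 by rewrite addr_ge0.
apply: ltr_wpDl; first exact: mulr_ge0.
exact: mulr_gt0.
Qed.

Lemma powdev_mul (z u : R) : 0 <= z -> 0 <= u ->
  powdev al be (z * u) - powdev al be z =
  al * z `^ be * (u `^ be - 1) - be * z `^ al * (u `^ al - 1).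
Proof. by move=> z0 u0; rewrite /powdev !powRM//; ring. Qed.

(** With z' = z u, the increment is z^al [powdev al be u] plus al (z^be - z^al)(u^be - 1), and all
    factors are nonnegative when z, u >= 1. In the decreasing case below both factors of the last
    product change sign. *)
Lemma powdev_incr (z z' : R) : 1 <= z -> z <= z' ->
  powdev al be z <= powdev al be z'.
Proof.
move=> z1 zz'; have z0 : 0 < z by rewrite (lt_le_trans ltr01).
have u1 : 1 <= z' / z by rewrite ler_pdivlMr// mul1r.
have u0 := le_trans ler01 u1.
have : z' = z * (z' / z) by rewrite mulrC divfK// gt_eqF.
move: (z' / z) u1 u0 => u u1 u0 ->.
rewrite -subr_ge0 (powdev_mul (ltW z0) u0).
have zab : z `^ al <= z `^ be by rewrite ler_powR// ltW.
have ub : 1 <= u `^ be.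
  by rewrite -[leLHS](powRr0 u) ler_powR// ltW.
have := powdev_ge0 u0; rewrite /powdev.
have za0 := powR_ge0 z al.
move: (z `^ al) (z `^ be) (u `^ al) (u `^ be) za0 zab ub => A B U V A0 AB V1 h.
have -> : al * B * (V - 1) - be * A * (U - 1) =
  A * (al * (V - 1) - be * (U - 1)) + al * ((B - A) * (V - 1)) by ring.
rewrite addr_ge0 ?mulr_ge0// ?subr_ge0//; exact: ltW.
Qed.

Lemma powdev_decr (z z' : R) : 0 <= z' -> z' <= z -> z <= 1 ->
  powdev al be z <= powdev al be z'.
Proof.
move=> z'0 zz' z1; have [z0|zn0] := eqVneq z 0.
  by have -> : z' = z by apply/le_anti; rewrite zz' z0.
have z0 : 0 < z by rewrite lt_neqAle eq_sym zn0 (le_trans z'0).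
have u1 : z' / z <= 1 by rewrite ler_pdivrMr// mul1r.
have u0 : 0 <= z' / z by rewrite divr_ge0// ltW.
have : z' = z * (z' / z) by rewrite mulrC divfK// gt_eqF.
move: (z' / z) u1 u0 => u u1 u0 ->.
rewrite -subr_ge0 (powdev_mul (ltW z0) u0).
have zab : z `^ be <= z `^ al by rewrite ger_powR// ?z0// ltW.
have ub : u `^ be <= 1.
  have := ge0_ler_powR (ltW be0) u0 (ler01 : 1 \is Num.nneg) u1.
  by rewrite powR1.
have := powdev_ge0 u0; rewrite /powdev.
have za0 := powR_ge0 z al.
move: (z `^ al) (z `^ be) (u `^ al) (u `^ be) za0 zab ub => A B U V A0 AB V1 h.
have -> : al * B * (V - 1) - be * A * (U - 1) =
  A * (al * (V - 1) - be * (U - 1)) + al * ((A - B) * (1 - V)) by ring.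
rewrite addr_ge0 ?mulr_ge0// ?subr_ge0//; exact: ltW.
Qed.

(** On the exponential scale the first order terms al be s cancel, so the gap is quadratic in s. *)
Lemma powdev_expR_le (s : R) : 0 <= s -> be * s <= 2^-1 ->
  powdev al be (expR s) <= 2 * al * be ^+ 2 * s ^+ 2.
Proof.
move=> s0 bs; rewrite /powdev -!expRM.
have h1 := expR_ge1Dx (s * al).
have bs0 : 0 <= be * s by rewrite mulr_ge0// ltW.
(* Taking inverses in exp(-c) >= 1 - c, with c = be s <= 1/2, bounds exp(c) by 1 / (1 - c), hence by
   1 + c + 2 c^2. *)
have h2 : expR (s * be) <= 1 + be * s + 2 * (be * s) ^+ 2.
  have := expR_ge1Dx (- (s * be)); rewrite expRN => h.
  have e0 := expR_gt0 (s * be).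
  have p0 : 0 < 1 - s * be by rewrite mulrC; lra.
  have : expR (s * be) <= (1 - s * be)^-1.
    by rewrite -[leLHS]invrK lef_pV2 ?posrE ?invr_gt0.
  move=> /le_trans; apply; rewrite -[leLHS]mul1r ler_pdivrMr//.
  rewrite [s * be]mulrC; move: (be * s) bs bs0 => c c1 c0.
  have -> : (1 + c + 2 * c ^+ 2) * (1 - c) = 1 + c ^+ 2 * (1 - 2 * c) by ring.
  by rewrite lerDl mulr_ge0 ?sqr_ge0//; lra.
have -> : 2 * al * be ^+ 2 * s ^+ 2 = al * (be * s + 2 * (be * s) ^+ 2) - be * (s * al).
  by ring.
by rewrite lerB// ler_pM2l//; lra.
Qed.

Lemma powdev_expR_small (w e : R) : 0 <= w -> 0 < e -> exists n : nat,
  n.+1%:R * powdev al be (expR (w / n.+1%:R)) <= e.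
Proof.
(* The first summand of [c] brings the final bound below [e]; the second ensures be w / n.+1 <= 1/2,
   as the quadratic estimate requires. *)
move=> w0 e0; pose c := 2 * al * be ^+ 2 * w ^+ 2 / e + be * w * 2.
have c1 : 0 <= be * w * 2 by rewrite !mulr_ge0// ltW.
have c2 : 0 <= 2 * al * be ^+ 2 * w ^+ 2 / e.
  by rewrite divr_ge0 ?mulr_ge0 ?sqr_ge0//; exact: ltW.
have c0 : 0 <= c by exact: addr_ge0.
pose n := Num.truncn c; exists n; have cn : c < n.+1%:R by apply: truncnS_gt.
have n0 : 0 < n.+1%:R :> R by [].
have h1 : be * (w / n.+1%:R) <= 2^-1.
  have h : be * w * 2 <= n.+1%:R.
    by apply: le_trans (ltW cn); rewrite lerDr; exact: c2.
  by rewrite mulrA ler_pdivrMr//; lra.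
have h2 : 0 <= w / n.+1%:R by rewrite divr_ge0.
rewrite (le_trans (ler_wpM2l (ltW n0) (powdev_expR_le h2 h1)))//.
have -> : n.+1%:R * (2 * al * be ^+ 2 * (w / n.+1%:R) ^+ 2) =
   (2 * al * be ^+ 2 * w ^+ 2 / e) * e / n.+1%:R.
  by field; rewrite !gt_eqF.
rewrite ler_pdivrMr// mulrC ler_pM2l// (le_trans _ (ltW cn))// lerDl; exact: c1.
Qed.

End Powdev.

(** * Operator valued measures *)

Section Rplus.
Variable R : realType.

Definition rborel (A : set R) : Prop := measurable A /\ A `<=` @Rplus R.

Lemma rborelT : rborel (@Rplus R).
Proof. by split => //; exact: measurable_itv. Qed.
Lemma rborel0 : rborel set0. Proof. by split. Qed.
Lemma rborelU A B : rborel A -> rborel B -> rborel (A `|` B).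
Proof.
by move=> [mA sA] [mB sB]; split; [exact: measurableU|rewrite subUset].
Qed.
Lemma rborelI A B : rborel A -> rborel B -> rborel (A `&` B).
Proof.
by move=> [mA sA] [mB sB]; split; [exact: measurableI|move=> x [/sA]].
Qed.
Lemma rborelD A B : rborel A -> rborel B -> rborel (A `\` B).
Proof.
by move=> [mA sA] [mB sB]; split; [exact: measurableD|move=> x [/sA]].
Qed.
Lemma rborel_bigcup (A : (set R)^nat) :
  (forall n, rborel (A n)) -> rborel (\bigcup_n A n).
Proof.
move=> bA; split; first by apply: bigcupT_measurable => n; case: (bA n).
by move=> x [n _]; case: (bA n) => _; apply.
Qed.
Lemma rborel_itv (i : interval R) : (BLeft 0 <= i.1)%O ->
  rborel [set` i].
Proof.
case: i => a b /= a0; split; first exact: measurable_itv.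
by move=> x /=; rewrite /Rplus /= !itv_boundlr => /andP[/(le_trans a0) -> _].
Qed.

End Rplus.

Section Povm.
Variables (R : realType) (H : lmodType R[i]) (ip : H -> H -> R[i]).
Hypothesis ipP : is_inner_product ip.
Local Notation rip := (re_ip ip).
Variable F : set R -> H -> H.
Hypothesis povmF : is_povm ip F.

(** The measures supplied by [is_povm] are only existential and unconstrained off R_+; [pm] records
    the part of them that [F] determines. *)
Definition pm (A : set R) (h : H) : R := rip (F A h) h.

Lemma povm_lin A : rborel A ->
  forall (a : R[i]) (u v : H), F A (a *: u + v) = a *: F A u + F A v.
Proof. by case=> mA sA; case: povmF => /(_ A mA sA)[]. Qed.

Lemma povm_im A h : rborel A -> complex.Im (ip (F A h) h) = 0.
Proof.
by case=> mA sA; case: povmF => _ /(_ h)[mu /(_ A mA sA)][].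
Qed.

Lemma qmeasureE h (mu : {measure set R -> \bar R}) A :
  qmeasure ip F h mu -> rborel A -> mu A = (pm A h)%:E.
Proof. by move=> q [mA sA]; case: (q A mA sA). Qed.

Lemma pm_ge0 A h : rborel A -> 0 <= pm A h.
Proof.
move=> bA; case: povmF => _ /(_ h)[mu q].
by rewrite -lee_fin -(qmeasureE q bA) measure_ge0.
Qed.

Lemma povm_sym A u v : rborel A -> rip (F A u) v = rip u (F A v).
Proof.
by move=> bA; apply: linop_sym => // [|h]; [exact: povm_lin|exact: povm_im].
Qed.

Lemma povm_psd A : rborel A -> psd_form (fun u v => rip (F A u) v).
Proof.
move=> bA; apply: linop_psd => // [|h|h];
  [exact: povm_lin|exact: povm_im|exact: pm_ge0].
Qed.

Lemma pmU A B h : rborel A -> rborel B -> A `&` B = set0 ->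
  pm (A `|` B) h = pm A h + pm B h.
Proof.
move=> bA bB AB; case: povmF => _ /(_ h)[mu q].
apply/EFin_inj; rewrite EFinD -!(qmeasureE q)//; last exact: rborelU.
by rewrite measureU//; [case: bA|case: bB].
Qed.

Lemma pm0 h : pm set0 h = 0.
Proof.
case: povmF => _ /(_ h)[mu q]; apply/EFin_inj.
by rewrite -(qmeasureE q) ?measure0//; exact: rborel0.
Qed.

Lemma pmD A B h : rborel A -> rborel B -> A `<=` B ->
  pm (B `\` A) h = pm B h - pm A h.
Proof.
move=> bA bB AB; rewrite -[in pm B h](setDUK AB) pmU//.
- by rewrite addrC addKr.
- exact: rborelD.
- by rewrite setDE setICA setICr setI0.
Qed.

Lemma pm_le A B h : rborel A -> rborel B -> A `<=` B -> pm A h <= pm B h.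
Proof.
by move=> bA bB AB; rewrite -subr_ge0 -pmD// pm_ge0//; exact: rborelD.
Qed.

Lemma pm_cvg (A : (set R)^nat) h : (forall n, rborel (A n)) ->
  nondecreasing_seq A -> pm (A n) h @[n --> \oo] --> pm (\bigcup_n A n) h.
Proof.
move=> bA ndA; case: povmF => _ /(_ h)[mu q].
have bU := rborel_bigcup bA.
have := @nondecreasing_cvg_mu _ _ _ mu A (fun n => proj1 (bA n)) bU.1 ndA.
rewrite (qmeasureE q bU) => /fine_cvgP[_ c].
rewrite (_ : (fun n => pm (A n) h) = fine \o (mu \o A)); first exact: c.
by apply/funext => n; rewrite /= (qmeasureE q).
Qed.

Lemma pm_bigcup_eq0 (A : (set R)^nat) h : (forall n, rborel (A n)) ->
  nondecreasing_seq A -> (forall n, pm (A n) h = 0) ->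
  pm (\bigcup_n A n) h = 0.
Proof.
move=> bA ndA A0; have := pm_cvg (h := h) bA ndA.
have -> : (fun n => pm (A n) h) = cst 0 by apply/funext.
by move=> /cvg_lim <-//; rewrite lim_cst.
Qed.

Lemma povmU A B h : rborel A -> rborel B -> A `&` B = set0 ->
  F (A `|` B) h = F A h + F B h.
Proof.
move=> bA bB AB; have bAB := rborelU bA bB; have rp := rip_psd ipP.
apply: (linop_ext ipP (M := fun h => F A h + F B h)) => [|a u v|||x].
- exact: povm_lin.
- by rewrite !povm_lin// scalerDr addrACA.
- by move=> u v; exact: povm_sym.
- by move=> u v; rewrite (psdDl rp) (psdDr rp) !povm_sym.
- by rewrite (psdDl rp); exact: pmU.
Qed.

(** By Cauchy-Schwarz for the form of [F A], a vector of zero mass is orthogonal to everything in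
    that form. *)
Lemma povm_pm0 A h : rborel A -> pm A h = 0 -> F A h = 0.
Proof.
move=> bA A0; apply: (rip_ext ipP) => w.
by rewrite (psd_null (povm_psd bA) w A0) (psd0l (rip_psd ipP)).
Qed.

Lemma povmD A B h : rborel A -> rborel B -> A `<=` B ->
  F B h = F A h + F (B `\` A) h.
Proof.
move=> bA bB AB; rewrite -[in LHS](setDUK AB) povmU//; first exact: rborelD.
by rewrite setDE setICA setICr setI0.
Qed.

End Povm.

(** * Projection valued measures *)

Section Pvm.
Variables (R : realType) (H : lmodType R[i]) (ip : H -> H -> R[i]).
Hypothesis ipP : is_inner_product ip.
Local Notation rip := (re_ip ip).
Variable E : set R -> H -> H.
Hypothesis pvmE : is_pvm ip E.

Lemma pvm_povm : is_povm ip E. Proof. by case: pvmE. Qed.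
Let povE := pvm_povm.

Lemma pvm_idem A h : rborel A -> E A (E A h) = E A h.
Proof. by case=> mA sA; case: pvmE => _ /(_ A mA sA)[]. Qed.

Lemma pvmT h : E (@Rplus R) h = h. Proof. by case: pvmE. Qed.

Lemma pm_pvm A h : rborel A -> pm ip E A h = rip (E A h) (E A h).
Proof. by move=> bA; rewrite (povm_sym ipP povE)// pvm_idem// (psdC (rip_psd ipP)). Qed.

Lemma pm_pvmT h : pm ip E (@Rplus R) h = rip h h.
Proof. by rewrite /pm pvmT. Qed.

(** At the vector [E B h] the set [B] already carries the full mass, so nothing is left for a
    disjoint [A]. *)
Lemma pvm_disj A B h : rborel A -> rborel B -> A `&` B = set0 ->
  E A (E B h) = 0.
Proof.
move=> bA bB AB; apply: (povm_pm0 ipP povE) => //.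
have bAB := rborelU bA bB; apply/le_anti; rewrite (pm_ge0 povE)// andbT.
have := pm_le povE (E B h) bAB (rborelT R) bAB.2.
rewrite (pmU povE)// pm_pvmT /pm pvm_idem//.
by rewrite -lerBrDr subrr.
Qed.

Lemma pvmI A B h : rborel A -> rborel B -> E A (E B h) = E (A `&` B) h.
Proof.
move=> bA bB; have bI := rborelI bA bB.
have bAB := rborelD bA bB; have bBA := rborelD bB bA.
have eB : E B h = E (A `&` B) h + E (B `\` A) h.
  rewrite (povmD ipP povE h bI bB (@subIsetr _ _ _)); congr (_ + E _ _).
  by apply/seteqP; split => y /=; tauto.
have eA x : E A x = E (A `&` B) x + E (A `\` B) x.
  rewrite (povmD ipP povE x bI bA (@subIsetl _ _ _)); congr (_ + E _ _).
  by apply/seteqP; split => y /=; tauto.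
rewrite eB (linopD (povm_lin povE bA)) (pvm_disj h bA bBA) ?addr0; last first.
  by rewrite -subset0 => y /=; tauto.
rewrite eA pvm_idem// (pvm_disj h bAB bI) ?addr0//.
by rewrite -subset0 => y /=; tauto.
Qed.

(** The remainder E(U \ B n) h has squared norm tending to 0, and [b] is dominated by the squared
    norm. *)
Lemma pvm_form_bigcup (b : H -> H -> R) (B : (set R)^nat) h : psd_form b ->
  (forall u, b u u <= rip u u) ->
  (forall n, rborel (B n)) -> nondecreasing_seq B ->
  (forall n, b (E (B n) h) (E (B n) h) = 0) ->
  b (E (\bigcup_n B n) h) (E (\bigcup_n B n) h) = 0.
Proof.
move=> pb ble bB ndB B0; set U := \bigcup_n B n; set x := b _ _.
have bU : rborel U by exact: rborel_bigcup.
have sU n : B n `<=` U by move=> y By; exists n.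
have xle n : x <= 2 * (pm ip E U h - pm ip E (B n) h).
  rewrite /x (povmD ipP povE h (bB n) bU (sU n)).
  rewrite (le_trans (psd_le2 pb _ _))// B0 add0r ler_pM2l//.
  rewrite (le_trans (ble _))// -pm_pvm; last exact: rborelD.
  by rewrite (pmD povE).
apply/le_anti; rewrite psd_ge0// andbT.
have c : 2 * (pm ip E U h - pm ip E (B n) h) @[n --> \oo] -->
    2 * (pm ip E U h - pm ip E U h).
  by apply: cvgM; [exact: cvg_cst|apply: cvgB; [exact: cvg_cst|exact: (pm_cvg povE)]].
rewrite subrr mulr0 in c; rewrite -(cvg_lim _ c)//.
by apply: limr_ge; [apply/cvg_ex; exists 0|exact: nearW].
Qed.

End Pvm.

(** * Integral bounds from pointwise bounds on a subset *)

Section RintegralBounds.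
Variables (R : realType) (mu : {measure set R -> \bar R}) (D A : set R) (f : R -> R).
Hypotheses (mD : measurable D) (mA : measurable A) (AD : A `<=` D).
Hypotheses (Doo : (mu D < +oo)%E) (intf : mu.-integrable D (EFin \o f)).

Lemma integrable_cst_on (B : set R) (c : R) : measurable B -> B `<=` D ->
  mu.-integrable B (EFin \o cst c).
Proof.
move=> mB BD; apply: measurable_bounded_integrable => //; last first.
  by exists `|c|; split; [exact: num_real|move=> M cM x _; exact: ltW].
by apply: le_lt_trans Doo; rewrite le_measure// inE.
Qed.

Lemma Rintegral_le_on (c : R) : mu (D `\` A) = 0%E ->
  (forall x, A x -> f x <= c) -> \int[mu]_(x in D) f x <= c * fine (mu D).
Proof.
move=> DA0 fc; have mDA : measurable (D `\` A) by exact: measurableD.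
have DDA : D `\` (D `\` A) = A by rewrite setDD setIidr.
have muDA : mu D = mu A.
  have AI : A `&` (D `\` A) = set0 by rewrite -subset0 => y /=; tauto.
  rewrite -{1}(setDUK AD) measureU//; transitivity (mu A + mu (D `\` A))%E => //.
  by rewrite DA0 adde0.
rewrite /Rintegral (negligible_integral mDA mD intf DA0) DDA muDA -(Rintegral_cst mu mA).
apply: le_Rintegral => //; first exact: integrableS intf.
exact: integrable_cst_on.
Qed.

Lemma Rintegral_ge_on (c : R) : (forall x, D x -> 0 <= f x) ->
  (forall x, A x -> c <= f x) -> c * fine (mu A) <= \int[mu]_(x in D) f x.
Proof.
move=> f0 fc; rewrite -[in leRHS](setDUK AD) Rintegral_setU//; last 3 first.
- exact: measurableD.
- by rewrite setDUK.
- by apply/disj_setPS => y /=; tauto.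
rewrite -(Rintegral_cst mu mA) -[leLHS]addr0 lerD//; last first.
  by apply: Rintegral_ge0 => x [/f0].
apply: le_Rintegral => //; first exact: integrable_cst_on.
exact: integrableS intf.
Qed.

End RintegralBounds.

(** * Criteria for a POV measure to equal a projection valued one *)

Section PovmEqPvm.
Variables (R : realType) (H : lmodType R[i]) (ip : H -> H -> R[i]).
Hypothesis ipP : is_inner_product ip.
Local Notation rip := (re_ip ip).
Variables E F : set R -> H -> H.
Hypotheses (pvmE : is_pvm ip E) (povmF : is_povm ip F).
Let povmE := pvm_povm pvmE.

Lemma setC_itv0c (a : R) : 0 <= a -> @Rplus R `\` `[0, a] = `]a, +oo[%classic.
Proof.
move=> a0; apply/seteqP; split => x; rewrite /Rplus /= !in_itv/= !andbT.
  by move=> [x0 /negP]; rewrite x0/= -ltNge.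
by move=> ax; have x0 := le_trans a0 (ltW ax); split => //; apply/negP; rewrite x0/= -ltNge.
Qed.

Lemma povm_eq_of_pm : (forall h a, 0 <= a -> pm ip F `[0, a] h = pm ip E `[0, a] h) ->
  (forall h, pm ip F (@Rplus R) h = pm ip E (@Rplus R) h) ->
  forall A h, rborel A -> F A h = E A h.
Proof.
move=> eFE eT A h bA.
have sF u v := povm_sym ipP povmF u v bA.
have sE u v := povm_sym ipP povmE u v bA.
apply: (linop_ext ipP (povm_lin povmF bA) (povm_lin povmE bA) sF sE) => k.
have [mu qmu] := povmF.2 k; have [nu qnu] := povmE.2 k.
have [mR _] := rborelT R.
(* The two measures are known only on subsets of R_+, so they are restricted before being compared
   on the whole line. *)
pose mu' := mrestr mu mR; pose nu' := mrestr nu mR.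
suff e : mu' A = nu' A.
  apply/EFin_inj; rewrite -(qmeasureE qmu bA) -(qmeasureE qnu bA).
  by move: e; rewrite /mu' /nu' /mrestr setIidl; case: bA.
have ray x : mu' `]x, +oo[%classic = nu' `]x, +oo[%classic.
  rewrite /mu' /nu' /mrestr; have [x0|x0] := leP 0 x.
    have b0x : rborel (`[0, x]%classic : set R) by apply: rborel_itv; rewrite bnd_simp.
    rewrite setIidl; last by rewrite -setC_itv0c//; exact: subDsetl.
    have bx : rborel (`]x, +oo[%classic : set R) by apply: rborel_itv; rewrite bnd_simp.
    rewrite (qmeasureE qmu bx) (qmeasureE qnu bx) -setC_itv0c//.
    by rewrite (pmD povmF k b0x (rborelT R) b0x.2) (pmD povmE k b0x (rborelT R) b0x.2)
      eFE// eT.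
  rewrite setIidr; last first.
    by move=> y; rewrite /Rplus /= !in_itv/= !andbT; exact: lt_le_trans.
  by rewrite (qmeasureE qmu (rborelT R)) (qmeasureE qnu (rborelT R)) eT.
(* Open rays are stable under intersection, generate the Borel sets, and the rays ]-k, +oo[ exhaust
   the line with finite mass. *)
apply: (@measure_unique _ _ _ (@RGenOInfty.G R) (fun k => `](- k%:R), +oo[%classic)) => //.
- exact: RGenOInfty.measurableE.
- move=> _ _ [x ->] [y ->]; exists (Num.max x y); apply/seteqP; split => z /=;
    rewrite !in_itv/= !andbT gt_max; [by case=> -> ->|by move/andP].
- by move=> i; exists (- i%:R).
- apply/seteqP; split => // x _; exists (Num.truncn `|x|).+1 => //=.
  by rewrite in_itv/= andbT ltrNl (le_lt_trans (ler_norm _))// normrN truncnS_gt.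
- by move=> _ [x ->]; exact: ray.
- move=> i; rewrite /mrestr; apply: (@le_lt_trans _ _ (mu (@Rplus R))).
    apply: le_measure => //; rewrite inE; last exact: mR.
    by apply: measurableI => //; exact: measurable_itv.
  by rewrite (qmeasureE qmu (rborelT R)) ltry.
- by case: bA.
Qed.

(** F([0, a]) kills the range of E(]a, +oo[) and fixes that of E([0, a]), so it equals E([0, a]).
    The criterion serves both the two-moment argument and the uniqueness of the spectral measure. *)
Lemma povm_eq_pvm :
  (forall a h, 0 <= a -> F `[0, a] (E `]a, +oo[ h) = 0) ->
  (forall a h, 0 <= a -> F `]a, +oo[ (E `[0, a] h) = 0) ->
  (forall h, F (@Rplus R) h = h) ->
  forall A h, rborel A -> F A h = E A h.
Proof.
move=> F1 F2 FT; apply: povm_eq_of_pm => [h a a0|h]; last by rewrite /pm FT (pvmT pvmE).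
have b0a : rborel (`[0, a]%classic : set R) by apply: rborel_itv; rewrite bnd_simp.
have e k := povmD ipP povmF k b0a (rborelT R) b0a.2.
have e' := povmD ipP povmE h b0a (rborelT R) b0a.2.
rewrite (pvmT pvmE) setC_itv0c// in e'.
have /esym := e (E `[0, a]%classic h); rewrite setC_itv0c// F2// addr0 FT => eF.
rewrite /pm; congr (complex.Re (ip _ _)).
by rewrite {1}e' (linopD (povm_lin povmF b0a)) F1// addr0.
Qed.

End PovmEqPvm.

(** * Vanishing along geometric partitions *)

Section IntervalLimits.
Variable R : realType.

Lemma invS_lt (e : R) : 0 < e -> exists n : nat, n.+1%:R^-1 < e.
Proof.
move=> e0; exists (Num.truncn e^-1).
by rewrite -[ltRHS]invrK ltf_pV2 ?posrE ?invr_gt0// truncnS_gt.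
Qed.

(** Pieces that are bounded and stay away from [x] allow geometric partitions with a positive left
    end even when [x = 0]. *)
Lemma itvoy_bigcup_itvoc (x : R) :
  `]x, +oo[%classic = \bigcup_n (`]x + n.+1%:R^-1, x + n.+2%:R]%classic : set R).
Proof.
apply/seteqP; split => y /=; rewrite ?in_itv/= ?andbT; [move=> xy|move=> [n _]].
  have [n nxy] : exists n : nat, n.+1%:R^-1 < y - x by apply: invS_lt; rewrite subr_gt0.
  exists (n + Num.truncn (y - x))%N => //=; rewrite in_itv/=; apply/andP; split.
    rewrite -ltrBrDl (le_lt_trans _ nxy)// lef_pV2 ?posrE// ler_nat ltnS.
    exact: leq_addr.
  rewrite -lerBlDl (le_trans (ltW (truncnS_gt _)))// ler_nat.
  by rewrite !ltnS leqW// leq_addl.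
rewrite /= in_itv/= => /andP[xy _]; rewrite (lt_trans _ xy)// ltrDl//.
Qed.

Lemma itvoy_bigcup_itvcy (x : R) :
  `]x, +oo[%classic = \bigcup_n (`[x + n.+1%:R^-1, +oo[%classic : set R).
Proof.
apply/seteqP; split => y /=; rewrite ?in_itv/= ?andbT; [move=> xy|move=> [n _]].
  have [n nxy] : exists n : nat, n.+1%:R^-1 < y - x by apply: invS_lt; rewrite subr_gt0.
  by exists n => //=; rewrite in_itv/= andbT -lerBrDl ltW.
by rewrite /= in_itv/= andbT => xy; rewrite (lt_le_trans _ xy)// ltrDl.
Qed.

(** Denominators start at 2, so every left end is strictly below [c]. *)
Lemma itv0oc_bigcup (c : R) : 0 < c ->
  `]0, c]%classic = \bigcup_n (`]c / n.+2%:R, c]%classic : set R).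
Proof.
move=> c0; apply/seteqP; split => y /=; rewrite ?in_itv/= ; [move=> /andP[y0 yc]|move=> [n _]].
  have [n ny] : exists n : nat, n.+1%:R^-1 < y / c by apply: invS_lt; rewrite divr_gt0.
  exists n => //=; rewrite in_itv/= yc andbT mulrC -ltr_pdivlMr//.
  by rewrite (le_lt_trans _ ny)// lef_pV2 ?posrE// ler_nat.
by rewrite /= in_itv/= => /andP[xy ->]; rewrite (lt_trans _ xy)// divr_gt0.
Qed.

Lemma invS_le (m n : nat) : (m <= n)%N -> n.+1%:R^-1 <= m.+1%:R^-1 :> R.
Proof. by move=> mn; rewrite lef_pV2 ?posrE// ler_nat. Qed.

Lemma nd_itvoc (x : R) :
  nondecreasing_seq (fun n => `]x + n.+1%:R^-1, x + n.+2%:R]%classic : set R).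
Proof.
move=> m n mn; rewrite subsetEset => y /=; rewrite !in_itv/= => /andP[xy yx].
rewrite (le_lt_trans _ xy) ?lerD2l ?invS_le//= (le_trans yx)// lerD2l ler_nat.
by rewrite !ltnS.
Qed.

Lemma nd_itvcy (x : R) :
  nondecreasing_seq (fun n => `[x + n.+1%:R^-1, +oo[%classic : set R).
Proof.
move=> m n mn; rewrite subsetEset => y /=; rewrite !in_itv/= !andbT.
by apply: le_trans; rewrite lerD2l invS_le.
Qed.

Lemma nd_itv0oc (c : R) : 0 < c ->
  nondecreasing_seq (fun n => `]c / n.+2%:R, c]%classic : set R).
Proof.
move=> c0 m n mn; rewrite subsetEset => y /=; rewrite !in_itv/= => /andP[xy ->].
by rewrite (le_lt_trans _ xy)// ler_pM2l// invS_le.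
Qed.

End IntervalLimits.

Section GeometricPartition.
Variables (R : realType) (H : lmodType R[i]) (ip : H -> H -> R[i]).
Hypothesis ipP : is_inner_product ip.
Local Notation rip := (re_ip ip).
Variable E : set R -> H -> H.
Hypothesis pvmE : is_pvm ip E.
Let povmE := pvm_povm pvmE.
Variable b : H -> H -> R.
Hypothesis psd_b : psd_form b.
Variables al be K a c : R.
Hypotheses (al0 : 0 < al) (albe : al < be) (a0 : 0 < a) (ac : a < c) (K0 : 0 <= K).
Hypothesis b_le : forall t rho h, a <= t -> 1 < rho -> t * rho <= c ->
  b (E `]t, t * rho] h) (E `]t, t * rho] h) <=
  K * powdev al be rho * rip (E `]t, t * rho] h) (E `]t, t * rho] h).

(* Cutting ]a, c] into n geometric pieces costs a factor n by convexity of [b],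
   while [powdev al be rho] is [O(n^-2)] on each piece. *)
Lemma pvm_geometric h : b (E `]a, c] h) (E `]a, c] h) = 0.
Proof.
set x := b _ _; have x0 : 0 <= x by exact: psd_ge0.
have key e : 0 < e -> x <= K * e * rip h h.
  (* With ratio exp(w / n.+1), exactly n.+1 geometric steps lead from [a] to [c]. *)
  move=> e0; pose w := ln (c / a).
  have ca1 : 1 < c / a by rewrite ltr_pdivlMr// mul1r.
  have w0 : 0 < w by rewrite ln_gt0.
  have [n nG] := powdev_expR_small al0 albe (ltW w0) e0.
  set rho := expR (w / n.+1%:R) in nG.
  have rho1 : 1 < rho by rewrite expR_gt1 divr_gt0.
  pose t k := a * rho ^+ k.
  have tn : t n.+1 = c.
    rewrite /t -expRM_natl mulrCA divff// mulr1 lnK ?posrE ?(lt_trans ltr01)//.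
    by rewrite mulrC divfK// gt_eqF.
  have tS k : t k.+1 = t k * rho by rewrite /t exprSr mulrA.
  have tle k m : (k <= m)%N -> t k <= t m.
    by move=> km; rewrite ler_pM2l// ler_weXn2l// ltW.
  have ta k : a <= t k by rewrite -[leLHS]mulr1 -(expr0 rho); exact: tle.
  have bor y z : a <= y -> rborel (`]y, z]%classic : set R).
    by move=> ay; apply: rborel_itv; rewrite bnd_simp ltW// (lt_le_trans a0).
  have sumE m : E `]a, t m] h = \sum_(i < m) E `]t i, t i.+1] h.
    elim: m => [|m IH].
      rewrite big_ord0 /t expr0 mulr1 set_itvoc0//.
      by apply: (povm_pm0 ipP povmE); [exact: rborel0|exact: pm0].
    rewrite big_ord_recr/= -IH -(povmU ipP povmE); [|exact: bor|exact: bor|].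
      congr (E _ h); apply/seteqP; split => y /=; rewrite !in_itv/=.
        by move=> /andP[-> ->]; have [|] := leP y (t m); [left|right].
      move=> [/andP[-> ym]|/andP[my ->]]; first by rewrite (le_trans ym)//= tle.
      by rewrite (le_lt_trans _ my).
    rewrite -subset0 => y /=; rewrite !in_itv/= => -[/andP[_ y1] /andP[y2 _]].
    by have := lt_le_trans y2 y1; rewrite ltxx.
  rewrite /x -tn sumE (le_trans (psd_sum_le psd_b _))//.
  have G0 : 0 <= powdev al be rho by rewrite powdev_ge0// ltW// expR_gt0.
  have h1 : \sum_(i < n.+1) b (E `]t i, t i.+1] h) (E `]t i, t i.+1] h) <=
      K * powdev al be rho * rip h h.
    (* As projections, the pieces satisfy |E_i h|^2 = <E_i h, h>; these add up to <E(]a, c]) h, h>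
       <= |h|^2. *)
    apply: (@le_trans _ _ (\sum_(i < n.+1) K * powdev al be rho * rip (E `]t i, t i.+1] h) h)).
      apply: ler_sum => i _; rewrite (_ : rip _ h = rip (E `]t i, t i.+1] h) (E `]t i, t i.+1] h)).
        by rewrite tS; apply: b_le => //; rewrite -tS -tn tle.
      by rewrite -(pm_pvm ipP pvmE)//; exact: bor.
    rewrite -mulr_sumr -(psd_suml (rip_psd ipP)) -sumE tn ler_wpM2l ?mulr_ge0//.
    by rewrite -(pm_pvmT pvmE) (pm_le povmE)//; [exact: bor|exact: rborelT|case: (bor a c (lexx a))].
  rewrite (le_trans (ler_wpM2l (ler0n _ _) h1))//.
  have -> : n.+1%:R * (K * powdev al be rho * rip h h) =
    K * (n.+1%:R * powdev al be rho) * rip h h by ring.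
  by rewrite ler_wpM2r ?psd_ge0 ?ler_wpM2l//; exact: rip_psd.
have N0 : 0 <= rip h h by apply: psd_ge0; exact: rip_psd.
apply/eqP; rewrite eq_le x0 andbT leNgt; apply/negP => xp.
(* Taking e = x / (K |h|^2 + 1) in [key] gives x < x; the added 1 keeps the denominator positive. *)
have p0 : 0 < K * rip h h + 1 by rewrite ltr_wpDl// mulr_ge0.
have xe : x / (K * rip h h + 1) * (K * rip h h + 1) = x by rewrite divfK// gt_eqF.
have q0 := divr_gt0 xp p0; have := key _ q0.
move: (x / _) q0 xe => q q0 <-; lra.
Qed.

End GeometricPartition.

(** * Two moments determine the measure *)

Section TwoMoments.
Variables (R : realType) (H : lmodType R[i]) (ip : H -> H -> R[i]).
Hypothesis ipP : is_inner_product ip.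
Local Notation rip := (re_ip ip).
Local Notation Rp := (@Rplus R).
Let rp := rip_psd ipP.

Lemma opintegralE (F : set R -> H -> H) f S h (mu : {measure set R -> \bar R}) :
  is_opintegral ip F f S -> qmeasure ip F h mu ->
  mu.-integrable Rp (EFin \o f) /\ rip (S h) h = \int[mu]_(x in Rp) f x.
Proof. by move=> [_ /(_ h mu)] + q => /(_ q)[? e]; split => //; rewrite /re_ip e. Qed.

Variables al be : R.
Hypotheses (al0 : 0 < al) (albe : al < be).
Variables Sa Sb : H -> H.

(** This is psi_t of the overview, in a scaled form in which bounds depend only on the ratio x /
    t. *)
Definition tpowdev (t x : R) : R := t `^ be * powdev al be (x / t).

Lemma tpowdevE t x : 0 < t -> 0 <= x -> tpowdev t x =
  al * x `^ be - be * t `^ (be - al) * x `^ al + (be - al) * t `^ be.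
Proof.
move=> t0 x0; have tn0 : t != 0 by rewrite gt_eqF.
have e p : (x / t) `^ p = x `^ p * (t `^ p)^-1.
  rewrite powRM// ?invr_ge0 ?(ltW t0)// -(powR_inv1 (ltW t0)).
  by rewrite -powRrM mulN1r powRN.
rewrite /tpowdev /powdev !e powRB ?tn0 ?implybT//.
have := powR_gt0 al t0; have := powR_gt0 be t0.
move: (t `^ al) (t `^ be) (x `^ al) (x `^ be) => A B X Y B0 A0.
by field; rewrite !gt_eqF.
Qed.

(** Beyond the operators [Sa] and [Sb], only the total mass of [F] enters, so measures with equal
    moments differ here only by their mass term. *)
Lemma tpowdev_integral (F : set R -> H -> H) (t : R) h (mu : {measure set R -> \bar R}) :
  is_opintegral ip F (fun x => x `^ al) Sa ->
  is_opintegral ip F (fun x => x `^ be) Sb ->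
  qmeasure ip F h mu -> 0 < t ->
  mu.-integrable Rp (EFin \o tpowdev t) /\
  \int[mu]_(x in Rp) tpowdev t x = al * rip (Sb h) h
    - be * t `^ (be - al) * rip (Sa h) h + (be - al) * t `^ be * pm ip F Rp h.
Proof.
move=> iSa iSb q t0; have [mR _] := rborelT R.
have [ia ea] := opintegralE iSa q; have [ib eb] := opintegralE iSb q.
have muE := qmeasureE q (rborelT R).
have muoo : (mu Rp < +oo)%E by rewrite muE ltry.
have ic c : mu.-integrable Rp (EFin \o cst c).
    exact: (integrable_cst_on mR muoo c mR (@subset_refl _ _)).
have iZ c f : mu.-integrable Rp (EFin \o f) ->
    mu.-integrable Rp (EFin \o (fun x => c * f x)).
  by move=> fi; apply: eq_integrable (integrableZl mR c fi).
have i1 := iZ al _ ib; have i2 := iZ (be * t `^ (be - al)) _ ia.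
have i3 : mu.-integrable Rp (EFin \o
    (fun x => al * x `^ be - be * t `^ (be - al) * x `^ al)).
  by apply: eq_integrable (integrableB mR i1 i2).
have eqf : {in Rp, tpowdev t =1 (fun x => al * x `^ be - be * t `^ (be - al) * x `^ al
    + cst ((be - al) * t `^ be) x)}.
  by move=> x; rewrite inE /Rplus /= in_itv/= andbT => x0; rewrite tpowdevE.
split.
  apply: eq_integrable (integrableD mR i3 (ic ((be - al) * t `^ be))) => // x xR.
  by rewrite /= -EFinD eqf.
rewrite (eq_Rintegral _ eqf) RintegralD// /cst/= Rintegral_cst// RintegralB// !RintegralZl//.
by rewrite -ea -eb muE.
Qed.

Variables E F : set R -> H -> H.
Hypotheses (pvmE : is_pvm ip E) (povmF : is_povm ip F).
Let povmE := pvm_povm pvmE.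
Hypotheses (aE : is_opintegral ip E (fun x => x `^ al) Sa)
  (bE : is_opintegral ip E (fun x => x `^ be) Sb)
  (aF : is_opintegral ip F (fun x => x `^ al) Sa)
  (bF : is_opintegral ip F (fun x => x `^ be) Sb).
Hypothesis F_le1 : forall h, pm ip F Rp h <= rip h h.
Hypothesis E0 : forall h, E [set 0] h = 0.

Let borb (t s : R) : 0 <= t -> rborel (`]t, s]%classic : set R).
Proof. by move=> t0; apply: rborel_itv; rewrite bnd_simp. Qed.

(* Both measures give [tpowdev t] the same integral up to the mass defect of
   [F], and [E] charges only ]t, t * rho] at [u]. *)
Lemma moment_gap (t rho : R) h (u := E `]t, t * rho] h) : 0 < t -> 1 < rho ->
  exists mu : {measure set R -> \bar R}, [/\ qmeasure ip F u mu,
    mu.-integrable Rp (EFin \o tpowdev t) &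
    \int[mu]_(x in Rp) tpowdev t x + (be - al) * t `^ be * (rip u u - pm ip F Rp u)
      <= t `^ be * powdev al be rho * rip u u].
Proof.
move=> t0 rho1; have [mu qmu] := povmF.2 u; have [nu qnu] := povmE.2 u.
have [imu emu] := tpowdev_integral aF bF qmu t0.
have [inu enu] := tpowdev_integral aE bE qnu t0.
exists mu; split => //; rewrite mulrBr -(pm_pvmT pvmE).
have bJ : rborel (`]t, t * rho]%classic : set R) by apply: borb; exact: ltW.
have nuE := qmeasureE qnu (rborelT R).
have nuoo : (nu Rp < +oo)%E by rewrite nuE ltry.
have le_nu : \int[nu]_(x in Rp) tpowdev t x <=
    t `^ be * powdev al be rho * fine (nu Rp).
  apply: (Rintegral_le_on (rborelT R).1 bJ.1 bJ.2 nuoo inu).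
  - have bD := rborelD (rborelT R) bJ.
    rewrite (qmeasureE qnu bD) /pm (pvm_disj ipP pvmE) ?(psd0l rp)//.
    by rewrite -subset0 => y /=; tauto.
  - move=> x /=; rewrite in_itv/= => /andP[tx xt].
    rewrite ler_wpM2l ?powR_ge0// powdev_incr//.
      by rewrite ler_pdivlMr// mul1r ltW.
    by rewrite ler_pdivrMr// mulrC.
by move: le_nu; rewrite nuE /= enu emu; lra.
Qed.

Lemma tpowdev_ge0 t x : 0 < t -> Rp x -> 0 <= tpowdev t x.
Proof.
move=> t0; rewrite /Rplus /= in_itv/= andbT => x0.
by rewrite mulr_ge0 ?powR_ge0// powdev_ge0// divr_ge0// ltW.
Qed.

(** The nonnegative integral in [moment_gap] is dropped and t^be cancels, leaving a bound uniform in
    [t]. *)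
Lemma moment_gap_mass (t rho : R) h (u := E `]t, t * rho] h) : 0 < t -> 1 < rho ->
  rip u u - pm ip F Rp u <= (be - al)^-1 * powdev al be rho * rip u u.
Proof.
move=> t0 rho1; have [mu [qmu imu le_mu]] := moment_gap h t0 rho1.
have d0 : 0 < be - al by rewrite subr_gt0.
have tb0 := powR_gt0 be t0.
have i0 : 0 <= \int[mu]_(x in Rp) tpowdev t x.
  by apply: Rintegral_ge0 => x; exact: tpowdev_ge0.
rewrite -(ler_pM2l d0) -(ler_pM2l tb0).
have -> : t `^ be * ((be - al) * ((be - al)^-1 * powdev al be rho * rip u u)) =
  t `^ be * powdev al be rho * rip u u by field; rewrite gt_eqF.
apply: le_trans le_mu; rewrite mulrA [t `^ be * _]mulrC -[leLHS]add0r lerD2r.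
exact: i0.
Qed.

(** Here the mass defect, nonnegative by [F_le1], is dropped, and the integral is bounded below by
    its part over [A], where [tpowdev t] is at least k t^be. *)
Lemma moment_gap_far (A : set R) (k t rho : R) h (u := E `]t, t * rho] h) :
  rborel A -> 0 < k -> 0 < t -> 1 < rho ->
  (forall x, A x -> k <= powdev al be (x / t)) ->
  pm ip F A u <= k^-1 * powdev al be rho * rip u u.
Proof.
move=> bA k0 t0 rho1 kA; have [mu [qmu imu le_mu]] := moment_gap h t0 rho1.
have d0 : 0 < be - al by rewrite subr_gt0.
have tb0 := powR_gt0 be t0.
have muoo : (mu Rp < +oo)%E by rewrite (qmeasureE qmu (rborelT R)) ltry.
have i0 : t `^ be * k * fine (mu A) <= \int[mu]_(x in Rp) tpowdev t x.
  apply: (Rintegral_ge_on (rborelT R).1 bA.1 bA.2 muoo imu) => x.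
    exact: tpowdev_ge0.
  by move=> Ax; rewrite ler_pM2l// kA.
rewrite (qmeasureE qmu bA)/= in i0.
rewrite -(ler_pM2l k0) -(ler_pM2l tb0).
have -> : t `^ be * (k * (k^-1 * powdev al be rho * rip u u)) =
  t `^ be * powdev al be rho * rip u u by field; rewrite gt_eqF.
apply: le_trans le_mu; rewrite mulrA -[leLHS]addr0 lerD//.
by rewrite mulr_ge0 ?mulr_ge0 ?subr_ge0// ltW.
Qed.

Lemma povm_form_le A u : rborel A -> rip (F A u) u <= rip u u.
Proof.
move=> bA; apply: le_trans (F_le1 u).
exact: (pm_le povmF u bA (rborelT R) bA.2).
Qed.

Let defect u v := rip (u - F Rp u) v.

Let psd_defect : psd_form defect.
Proof.
have lF := povm_lin povmF (rborelT R).
split => [u v|u v w|a u v|u]; rewrite /defect.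
- rewrite !(psdDl rp) !(psdNl rp) (psdC rp u v) (psdC rp (F Rp v) u).
  by rewrite (povm_sym ipP povmF u v (rborelT R)).
- by rewrite (linopD lF) opprD addrACA [LHS](psdDl rp).
- by rewrite (linopZ lF) -scalerBr (psdZl rp).
- by rewrite (psdDl rp) (psdNl rp) subr_ge0 F_le1.
Qed.

Lemma pvm_form_ray (b : H -> H -> R) (a : R) h : psd_form b ->
  (forall u, b u u <= rip u u) -> 0 <= a ->
  (forall x y, a < x -> x < y -> b (E `]x, y] h) (E `]x, y] h) = 0) ->
  b (E `]a, +oo[ h) (E `]a, +oo[ h) = 0.
Proof.
move=> pb ble a0 bxy; rewrite itvoy_bigcup_itvoc.
apply: (pvm_form_bigcup ipP pvmE pb ble) => [n||n].
- by apply: borb; rewrite addr_ge0.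
- exact: nd_itvoc.
- have [xy|yx] := ltP (a + n.+1%:R^-1) (a + n.+2%:R).
    by apply: bxy => //; rewrite ltrDl.
  rewrite set_itv_ge ?bnd_simp -?leNgt// (povm_pm0 ipP povmE (rborel0 R)) ?(psd0l pb)//.
  exact: (pm0 povmE).
Qed.

Lemma pvm_itv0y h : E `]0, +oo[ h = h.
Proof.
have b0 : rborel ([set 0] : set R).
  by rewrite -set_itv1; apply: rborel_itv; rewrite bnd_simp.
have b1 : rborel (`]0, +oo[%classic : set R) by apply: rborel_itv; rewrite bnd_simp.
rewrite -[RHS](pvmT pvmE) (povmD ipP povmE h b0 (rborelT R) b0.2) E0 add0r.
congr (E _ h); apply/seteqP; split => x; rewrite /Rplus /= !in_itv/= !andbT.
  by move=> x0; rewrite ltW//; split => //; apply/eqP; rewrite gt_eqF.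
by move=> [x0 /eqP xn0]; rewrite lt_neqAle eq_sym xn0.
Qed.

(** The defect form vanishes on the ranges of bounded intervals away from 0, hence at [h], since [E]
    has no mass at 0. Cauchy-Schwarz then turns the null form into a null vector. *)
Lemma two_moments_total h : F Rp h = h.
Proof.
have ble u : defect u u <= rip u u.
  by rewrite /defect (psdDl rp) (psdNl rp) gerDl oppr_le0 (pm_ge0 povmF)//; exact: rborelT.
have d0 : defect h h = 0.
  rewrite -[h](pvm_itv0y h); apply: (pvm_form_ray psd_defect ble) => // x y x0 xy.
  apply: (pvm_geometric ipP pvmE psd_defect (K := (be - al)^-1) al0 albe) => //.
    by rewrite invr_ge0 subr_ge0 ltW.
  move=> t rho k xt rho1 _; have t0 := lt_le_trans x0 xt.
  have := moment_gap_mass k t0 rho1.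
  by rewrite /defect (psdDl rp) (psdNl rp).
apply/esym/subr0_eq/(rip_ext ipP) => w; rewrite (psd0l rp).
exact: (psd_null psd_defect).
Qed.

(** For z <= a < x <= t the ratio z / t is at most a / x < 1, so [powdev] there is at least its
    positive value at a / x. *)
Lemma two_moments_low a h : 0 <= a -> F `[0, a] (E `]a, +oo[ h) = 0.
Proof.
move=> a0; have bA : rborel (`[0, a]%classic : set R).
  by apply: rborel_itv; rewrite bnd_simp.
have pb := povm_psd ipP povmF bA.
apply: (povm_pm0 ipP povmF bA).
apply: (pvm_form_ray pb) => // [u|x y ax xy]; first exact: povm_form_le.
have x0 : 0 < x := le_lt_trans a0 ax.
have k0 : 0 < powdev al be (a / x).
  by rewrite powdev_gt0 ?divr_ge0// ?(ltW x0)// lt_eqF// ltr_pdivrMr// mul1r.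
apply: (pvm_geometric ipP pvmE pb (K := (powdev al be (a / x))^-1) al0 albe) => //.
  by rewrite invr_ge0 ltW.
move=> t rho k xt rho1 _; have t0 := lt_le_trans x0 xt.
apply: moment_gap_far => // z /=; rewrite in_itv/= => /andP[z0 za].
apply: powdev_decr => //; first by rewrite divr_ge0// ltW.
  by rewrite ler_pM ?lef_pV2 ?posrE// invr_ge0 ltW.
by rewrite ler_pdivrMr// mul1r ltW.
Qed.

Lemma two_moments_high a h : 0 <= a -> F `]a, +oo[ (E `[0, a] h) = 0.
Proof.
move=> a0; have bA : rborel (`]a, +oo[%classic : set R).
  by apply: rborel_itv; rewrite bnd_simp.
have b0 : rborel ([set 0] : set R).
  by rewrite -set_itv1; apply: rborel_itv; rewrite bnd_simp.
have bI : rborel (`[0, a]%classic : set R) by apply: rborel_itv; rewrite bnd_simp.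
have s0 : [set 0] `<=` (`[0, a]%classic : set R).
  by move=> _ -> /=; rewrite in_itv/= lexx.
(* The point 0 is discarded because geometric partitions need a positive left end. *)
rewrite (povmD ipP povmE h b0 bI s0) E0 add0r.
have -> : `[0, a]%classic `\` [set 0] = `]0, a]%classic :> set R.
  apply/seteqP; split => x; rewrite /= !in_itv/=.
    by move=> [/andP[x0 ->] /eqP xn0]; rewrite lt_neqAle eq_sym xn0 x0.
  move=> /andP[x0 ->]; rewrite ltW//; split => //; apply/eqP; by rewrite gt_eqF.
apply: (povm_pm0 ipP povmF bA).
have [a00|an0] := eqVneq a 0.
  rewrite a00 set_itvoc0// (povm_pm0 ipP povmE (rborel0 R)) ?(pm0 povmE)//.
  by rewrite /pm (linop0 (povm_lin povmF _)) ?(psd0l rp)// -a00.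
have ap : 0 < a by rewrite lt_neqAle eq_sym an0.
have pb := povm_psd ipP povmF bA.
rewrite itv0oc_bigcup//; apply: (pvm_form_bigcup ipP pvmE pb) => [u|n||n].
- exact: povm_form_le.
- by apply: borb; rewrite divr_ge0.
- exact: nd_itv0oc.
(* Replacing ]a, +oo[ by [d, +oo[ with d > a keeps z / t above d / a > 1 for all t <= a, so that
   [powdev] is bounded away from 0. *)
rewrite itvoy_bigcup_itvcy; apply: (pm_bigcup_eq0 povmF) => [m||m].
- by apply: rborel_itv; rewrite bnd_simp addr_ge0.
- exact: nd_itvcy.
set d := a + m.+1%:R^-1; have ad : a < d by rewrite ltrDl.
have bd : rborel (`[d, +oo[%classic : set R).
  by apply: rborel_itv; rewrite bnd_simp addr_ge0.
have k0 : 0 < powdev al be (d / a).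
  by rewrite powdev_gt0 ?divr_ge0 ?addr_ge0// gt_eqF// ltr_pdivlMr// mul1r.
have x0 : 0 < a / n.+2%:R by rewrite divr_gt0.
apply: (pvm_geometric ipP pvmE (povm_psd ipP povmF bd) (K := (powdev al be (d / a))^-1) al0 albe) => //.
  by rewrite ltr_pdivrMr// ltr_pMr// ltr1n.
  by rewrite invr_ge0 ltW.
move=> t rho k xt rho1 ta; have t0 := lt_le_trans x0 xt.
have {}ta : t <= a by rewrite (le_trans _ ta)// ler_peMr// ltW.
apply: moment_gap_far => // z /=; rewrite in_itv/= andbT => dz.
apply: powdev_incr => //; first by rewrite ler_pdivlMr// mul1r ltW.
by rewrite ler_pM ?lef_pV2 ?posrE ?addr_ge0// invr_ge0.
Qed.

Theorem povm_eq_of_two_moments A h : rborel A -> F A h = E A h.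
Proof.
apply: (povm_eq_pvm ipP pvmE povmF); [exact: two_moments_low|
  exact: two_moments_high|exact: two_moments_total].
Qed.

End TwoMoments.

(** * Uniqueness of the spectral measure *)

Section SpectralMeasure.
Variables (R : realType) (H : lmodType R[i]) (ip : H -> H -> R[i]).
Hypothesis ipP : is_inner_product ip.
Local Notation rip := (re_ip ip).
Local Notation Rp := (@Rplus R).
Let rp := rip_psd ipP.
Variable T : H -> H.
Hypothesis linT : forall (a : R[i]) (u v : H), T (a *: u + v) = a *: T u + T v.
Hypothesis posT : positive_op ip T.

Let psdT : psd_form (fun u v => rip (T u) v).
Proof.
apply: (linop_psd ipP linT) => h; have := posT h; rewrite lecE => /andP[].
  by move=> /eqP.
by [].
Qed.

Section OneMeasure.
Variable E : set R -> H -> H.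
Hypothesis specE : spectral_measure_of ip T E.
Let pvmE : is_pvm ip E := specE.1.
Let povmE := pvm_povm pvmE.
Let intE : is_opintegral ip E id T := specE.2.

(** For [u] in the range of E({0}), <T u, u> is the integral of x over {0}, hence 0. Positivity
    gives T u = 0 and injectivity gives u = 0. *)
Lemma spectral_zero h : injective T -> E [set 0] h = 0.
Proof.
move=> injT; have b0 : rborel ([set 0] : set R).
  by rewrite -set_itv1; apply: rborel_itv; rewrite bnd_simp.
set u := E _ h; have [nu qnu] := povmE.2 u.
have [inu enu] := opintegralE intE qnu.
have nuoo : (nu Rp < +oo)%E by rewrite (qmeasureE qnu (rborelT R)) ltry.
have Tu0 : rip (T u) u = 0.
  apply/le_anti; rewrite (psd_ge0 psdT) andbT enu -[leRHS](mul0r (fine (nu Rp))).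
  apply: (Rintegral_le_on (rborelT R).1 b0.1 b0.2 nuoo inu) => [|x ->//].
  have bD := rborelD (rborelT R) b0.
  rewrite (qmeasureE qnu bD) /pm (pvm_disj ipP pvmE) ?(psd0l rp)//.
  by rewrite -subset0 => y /=; tauto.
apply: injT; rewrite (linop0 linT); apply: (rip_ext ipP) => w.
by rewrite (psd0l rp) (psd_null psdT).
Qed.

(** The integral is specified only through quadratic forms. As [E] has no cross terms between [u]
    and [v], the scalar measure of [u + v] is the sum of theirs, and expanding <T(u + v), u + v>
    leaves no mixed term. *)
Lemma spectral_orth A B x y : rborel A -> rborel B -> A `&` B = set0 ->
  rip (T (E A x)) (E B y) = 0.
Proof.
move=> bA bB AB; set u := E A x; set v := E B y.
have cross C : rborel C -> rip (E C u) v = 0.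
  move=> bC; rewrite /u /v -(povm_sym ipP povmE)//.
  rewrite !(pvmI ipP pvmE)//; last exact: rborelI.
  rewrite (_ : B `&` C `&` A = set0).
    by rewrite (povm_pm0 ipP povmE (rborel0 R)) ?(psd0l rp)// (pm0 povmE).
  by rewrite -subset0 -AB => z /=; tauto.
have [mu qmu] := povmE.2 u; have [nu qnu] := povmE.2 v.
have [imu emu] := opintegralE intE qmu; have [inu enu] := opintegralE intE qnu.
have qadd : qmeasure ip E (u + v) (measure_add mu nu).
  move=> C mC sC; have bC : rborel C by split.
  split; first exact: (povm_im povmE).
  transitivity (mu C + nu C)%E; first exact: measure_addE.
  rewrite (qmeasureE qmu bC) (qmeasureE qnu bC) -EFinD; congr EFin.
  have := psdD (povm_psd ipP povmE bC) u v; rewrite cross// mulr0 addr0.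
  by rewrite /pm /re_ip => ->.
have [_ eadd] := opintegralE intE qadd.
have : rip (T (u + v)) (u + v) = rip (T u) u + rip (T v) v.
  rewrite eadd emu enu /Rintegral integral_measure_add//.
  - by rewrite fineD//; apply: integrable_fin_num => //; exact: (rborelT R).1.
  - exact: (rborelT R).1.
rewrite (psdD psdT); lra.
Qed.

(** By orthogonality [T] is block diagonal for the range of [E A] and that of its complement. *)
Lemma spectral_comm A x : rborel A -> T (E A x) = E A (T x).
Proof.
move=> bA; have bB := rborelD (rborelT R) bA.
have AB : A `&` (Rp `\` A) = set0 by rewrite -subset0 => z /=; tauto.
have split_ y : y = E A y + E (Rp `\` A) y.
  by rewrite -(povmD ipP povmE y bA (rborelT R) bA.2) (pvmT pvmE).
have zBA : E (Rp `\` A) (T (E A x)) = 0.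
  apply: (rip_ext ipP) => w; rewrite (povm_sym ipP povmE)//.
  by rewrite spectral_orth// (psd0l rp).
have zAB : E A (T (E (Rp `\` A) x)) = 0.
  apply: (rip_ext ipP) => w; rewrite (povm_sym ipP povmE)//.
  by rewrite spectral_orth// ?(psd0l rp)// setIC.
rewrite [in RHS](split_ x) (linopD linT) (linopD (povm_lin povmE bA)) zAB addr0.
by rewrite [LHS]split_ zBA addr0.
Qed.

Lemma spectral_iter_comm A n x : rborel A -> iter n T (E A x) = E A (iter n T x).
Proof. by move=> bA; elim: n => //= n ->; rewrite spectral_comm. Qed.

Lemma spectral_upper a u : 0 <= a -> E `[0, a] u = u ->
  rip (T u) (T u) <= a ^+ 2 * rip u u.
Proof.
move=> a0; have bA : rborel (`[0, a]%classic : set R).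
  by apply: rborel_itv; rewrite bnd_simp.
have q_le v : E `[0, a] v = v -> rip (T v) v <= a * rip v v.
  move=> ev; have [nu qnu] := povmE.2 v; have [inu enu] := opintegralE intE qnu.
  have nuE := qmeasureE qnu (rborelT R).
  have nuoo : (nu Rp < +oo)%E by rewrite nuE ltry.
  rewrite enu -(pm_pvmT pvmE); have -> : pm ip E Rp v = fine (nu Rp) by rewrite nuE.
  apply: (Rintegral_le_on (rborelT R).1 bA.1 bA.2 nuoo inu); last first.
    by move=> x /=; rewrite in_itv/= => /andP[].
  have bD := rborelD (rborelT R) bA.
  rewrite (qmeasureE qnu bD) /pm -ev (pvm_disj ipP pvmE) ?(psd0l rp)//.
  by rewrite -subset0 => y /=; tauto.
move=> eu; have eTu : E `[0, a] (T u) = T u by rewrite -spectral_comm// eu.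
have [n0|nn0] := eqVneq (rip (T u) (T u)) 0.
  by rewrite n0 mulr_ge0 ?sqr_ge0// (psd_ge0 rp).
have n_gt0 : 0 < rip (T u) (T u) by rewrite lt_neqAle eq_sym nn0 (psd_ge0 rp).
(* Cauchy-Schwarz for the form of [T] gives |T u|^4 <= <T u, u> <T T u, T u>; both factors are
   controlled by [q_le], since T u stays in the range of E([0, a]). *)
rewrite -(ler_pM2r n_gt0) -expr2 (le_trans (psd_cs psdT u (T u)))//.
have -> : a ^+ 2 * rip u u * rip (T u) (T u) = (a * rip u u) * (a * rip (T u) (T u)).
  by ring.
by rewrite ler_pM ?(psd_ge0 psdT) ?q_le.
Qed.

Lemma spectral_iter_upper a u n : 0 <= a -> E `[0, a] u = u ->
  rip (iter n T u) (iter n T u) <= (a ^+ 2) ^+ n * rip u u.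
Proof.
move=> a0 eu; elim: n => [|n IH]; first by rewrite expr0 mul1r.
have bA : rborel (`[0, a]%classic : set R) by apply: rborel_itv; rewrite bnd_simp.
have en : E `[0, a] (iter n T u) = iter n T u by rewrite -spectral_iter_comm// eu.
rewrite (le_trans (spectral_upper a0 en))// (exprS _ n) -mulrA ler_wpM2l//.
exact: sqr_ge0.
Qed.

Lemma spectral_lower d u : 0 <= d -> E `[d, +oo[ u = u ->
  d ^+ 2 * rip u u <= rip (T u) (T u).
Proof.
move=> d0 eu; have bA : rborel (`[d, +oo[%classic : set R).
  by apply: rborel_itv; rewrite bnd_simp.
have [nu qnu] := povmE.2 u; have [inu enu] := opintegralE intE qnu.
have nuE := qmeasureE qnu (rborelT R).
have nuoo : (nu Rp < +oo)%E by rewrite nuE ltry.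
have low : d * rip u u <= rip (T u) u.
  have -> : rip u u = fine (nu `[d, +oo[%classic) by rewrite (qmeasureE qnu bA) /pm eu.
  rewrite enu; apply: (Rintegral_ge_on (rborelT R).1 bA.1 bA.2 nuoo inu) => x.
    by rewrite /Rplus /= in_itv/= andbT.
  by rewrite /= in_itv/= andbT.
have [n0|nn0] := eqVneq (rip u u) 0; first by rewrite n0 mulr0 (psd_ge0 rp).
have n_gt0 : 0 < rip u u by rewrite lt_neqAle eq_sym nn0 (psd_ge0 rp).
rewrite -(ler_pM2r n_gt0); apply: le_trans (psd_cs rp (T u) u).
have -> : d ^+ 2 * rip u u * rip u u = (d * rip u u) ^+ 2 by ring.
by rewrite ler_sqr ?nnegrE ?mulr_ge0// ?(psd_ge0 rp)// (psd_ge0 psdT).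
Qed.

Lemma spectral_iter_lower d u n : 0 <= d -> E `[d, +oo[ u = u ->
  (d ^+ 2) ^+ n * rip u u <= rip (iter n T u) (iter n T u).
Proof.
move=> d0 eu; elim: n => [|n IH]; first by rewrite expr0 mul1r.
have bA : rborel (`[d, +oo[%classic : set R).
  by apply: rborel_itv; rewrite bnd_simp.
have en : E `[d, +oo[ (iter n T u) = iter n T u by rewrite -spectral_iter_comm// eu.
apply: le_trans (spectral_lower d0 en); rewrite (exprS _ n) -mulrA ler_wpM2l//.
exact: sqr_ge0.
Qed.

End OneMeasure.

(* With [u] in the range of [E `[0, a]] and [k := E' `[d, +oo[ u], the powers
   of [T] grow at least like [d ^+ n] on [k] and at most like [a ^+ n] on [u]. *)
Lemma spectral_disjoint (E E' : set R -> H -> H) (a : R) h :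
  spectral_measure_of ip T E -> spectral_measure_of ip T E' -> 0 <= a ->
  E' `]a, +oo[%classic (E `[0, a]%classic h) = 0.
Proof.
move=> sE sE' a0; have pov' := pvm_povm sE'.1.
have bI : rborel (`]a, +oo[%classic : set R) by apply: rborel_itv; rewrite bnd_simp.
have bA : rborel (`[0, a]%classic : set R) by apply: rborel_itv; rewrite bnd_simp.
apply: (povm_pm0 ipP pov' bI); rewrite itvoy_bigcup_itvcy.
apply: (pm_bigcup_eq0 pov') => [m||m].
- by apply: rborel_itv; rewrite bnd_simp addr_ge0.
- exact: nd_itvcy.
set d := a + m.+1%:R^-1; have ad : a < d by rewrite ltrDl.
have d_gt0 : 0 < d := le_lt_trans a0 ad.
have bd : rborel (`[d, +oo[%classic : set R).
  by apply: rborel_itv; rewrite bnd_simp ltW.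
set u := E _ h; set k := E' `[d, +oo[%classic u.
have eu : E `[0, a]%classic u = u by exact: (pvm_idem sE.1).
have ek : E' `[d, +oo[%classic k = k by exact: (pvm_idem sE'.1).
have contr v : rip (E' `[d, +oo[%classic v) (E' `[d, +oo[%classic v) <= rip v v.
  by rewrite -(pm_pvm ipP sE'.1)// -(pm_pvmT sE'.1) (pm_le pov')//; [exact: rborelT|exact: bd.2].
rewrite (pm_pvm ipP sE'.1)// -/k.
pose q := a ^+ 2 / d ^+ 2.
have d2 : 0 < d ^+ 2 by rewrite exprn_gt0.
have q0 : 0 <= q by rewrite divr_ge0 ?sqr_ge0.
have q1 : `|q| < 1.
  by rewrite ger0_norm// ltr_pdivrMr// mul1r ltr_sqr ?nnegrE// ltW.
(* The chain is d^(2n) |k|^2 <= |T^n k|^2 = |E'([d, +oo[) T^n u|^2 <= |T^n u|^2 <= a^(2n) |u|^2. *)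
have le_n n : rip k k <= q ^+ n * rip u u.
  rewrite expr_div_n mulrAC ler_pdivlMr ?exprn_gt0// mulrC.
  apply: le_trans (spectral_iter_lower sE' n (ltW d_gt0) ek) _.
  apply: le_trans _ (spectral_iter_upper sE n a0 eu).
  by rewrite /k (spectral_iter_comm sE')//.
apply/le_anti; rewrite (psd_ge0 rp) andbT.
have c : (q ^+ n * rip u u) @[n --> \oo] --> 0 * rip u u.
  by apply: cvgM; [exact: cvg_expr|exact: cvg_cst].
rewrite mul0r in c; rewrite -(cvg_lim _ c)//.
by apply: limr_ge; [apply/cvg_ex; exists 0|exact: nearW].
Qed.

Theorem spectral_measure_unique (E E' : set R -> H -> H) :
  spectral_measure_of ip T E -> spectral_measure_of ip T E' ->
  forall A h, rborel A -> E' A h = E A h.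
Proof.
move=> sE sE'; apply: (povm_eq_pvm ipP sE.1 (pvm_povm sE'.1)) => [a h a0|a h a0|h].
- have bI : rborel (`]a, +oo[%classic : set R) by apply: rborel_itv; rewrite bnd_simp.
  have bA : rborel (`[0, a]%classic : set R) by apply: rborel_itv; rewrite bnd_simp.
  (* Passing to adjoints reduces this half to [spectral_disjoint] with the two measures
     exchanged. *)
  apply: (rip_ext ipP) => w.
  rewrite (povm_sym ipP (pvm_povm sE'.1))// (povm_sym ipP (pvm_povm sE.1))//.
  by rewrite (spectral_disjoint w sE' sE a0) (psdC rp) !(psd0l rp).
- exact: (spectral_disjoint h sE sE' a0).
- exact: (pvmT sE'.1).
Qed.

End SpectralMeasure.

(** * Existence of integrals of bounded functions *)

Section HilbertNorm.
Variables (R : realType) (H : lmodType R[i]) (ip : H -> H -> R[i]).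
Hypothesis ipP : is_inner_product ip.
Local Notation rip := (re_ip ip).
Let rp := rip_psd ipP.

Lemma hnorm_ge0 u : 0 <= hnorm ip u. Proof. exact: sqrtr_ge0. Qed.

Lemma hnorm_sqr u : hnorm ip u ^+ 2 = rip u u.
Proof. by rewrite hnormE sqr_sqrtr// (psd_ge0 rp). Qed.

Lemma hnorm_le (c : R) u v : 0 <= c ->
  (hnorm ip u <= c * hnorm ip v) = (rip u u <= c ^+ 2 * rip v v).
Proof.
move=> c0; rewrite -!hnorm_sqr -exprMn ler_sqr// nnegrE ?mulr_ge0//;
  exact: hnorm_ge0.
Qed.

Lemma rip_le_hnorm u v : `|rip u v| <= hnorm ip u * hnorm ip v.
Proof.
rewrite -ler_sqr ?nnegrE ?mulr_ge0//; try exact: hnorm_ge0.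
by rewrite real_normK ?num_real// exprMn !hnorm_sqr psd_cs.
Qed.

(* The quadratic form is polarized at [h] and [e^-1 D h]. *)
Lemma symmetric_norm_le (D : H -> H) (e : R) h :
  (forall (a : R[i]) (u v : H), D (a *: u + v) = a *: D u + D v) ->
  (forall u v, rip (D u) v = rip u (D v)) -> 0 < e ->
  (forall u, `|rip (D u) u| <= e * rip u u) -> rip (D h) (D h) <= e ^+ 2 * rip h h.
Proof.
move=> linD symD e0 De; set k := real_complex R e^-1 *: D h.
have q_le u v : 2 * rip (D u) v <= e * (rip u u + rip v v).
  have := De (u + v); have := De (u - v).
  rewrite !ler_norml => /andP[h1 _] /andP[_ h2]; move: h1 h2.
  rewrite (linopB linD) (linopD linD) !(psdDl rp) !(psdDr rp) !(psdNl rp) !(psdNr rp).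
  by rewrite (psdC rp v u) (psdC rp (D v) u) -(symD u v); lra.
have := q_le h k; rewrite /k (psdZr rp) (psdZl rp) (psdZr rp) => q.
have e_neq0 : e != 0 by rewrite gt_eqF.
rewrite -(ler_pM2l (_ : 0 < e^-1)) ?invr_gt0//.
have e1 : e * (e^-1 * (e^-1 * rip (D h) (D h))) = e^-1 * rip (D h) (D h).
  by field.
have e2 : e^-1 * (e ^+ 2 * rip h h) = e * rip h h by field.
by rewrite e2; move: q; rewrite mulrDr e1; lra.
Qed.

(** Imaginary parts become real inner products, so limits need only be taken for [rip]. *)
Lemma rip_Im (x h : H) : rip x ('i%C *: h) = complex.Im (ip x h).
Proof.
case: ipP => lin sym _ _.
have l0 w : ip 0 w = 0.
  have := lin 1 0 0 w; rewrite scale1r mul1r addr0 => /eqP.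
  by rewrite -subr_eq0 opprD addNKr oppr_eq0 => /eqP.
have e : ip ('i%C *: h) x = 'i%C * ip h x.
  by have := lin 'i%C h 0 x; rewrite !addr0 l0 addr0.
rewrite /re_ip (sym ('i%C *: h) x) (sym h x) e.
by case: (ip h x) => a b /=; ring.
Qed.

Lemma rip_Zl a x w : rip (a *: x) w = rip x (conjc a *: w).
Proof.
case: ipP => lin sym _ _.
have l0 v : ip 0 v = 0.
  have := lin 1 0 0 v; rewrite scale1r mul1r addr0 => /eqP.
  by rewrite -subr_eq0 opprD addNKr oppr_eq0 => /eqP.
have ipZ c y v : ip (c *: y) v = c * ip y v.
  by have := lin c y 0 v; rewrite !addr0 l0 addr0.
rewrite /re_ip ipZ (sym (conjc a *: w) x) ipZ (sym x w).
by case: (ip x w) => p q; case: a => r s /=; ring.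
Qed.

End HilbertNorm.

Section PovmIntegral.
Variables (R : realType) (H : lmodType R[i]) (ip : H -> H -> R[i]).
Hypothesis hilb : is_hilbert ip.
Let ipP : is_inner_product ip := hilb.1.
Local Notation rip := (re_ip ip).
Local Notation Rp := (@Rplus R).
Let rp := rip_psd ipP.
Variable F : set R -> H -> H.
Hypothesis povmF : is_povm ip F.
Variables (f : R -> R) (D : set R) (M : R).
Hypotheses (bD : rborel D) (D0 : forall h, pm ip F (Rp `\` D) h = 0).
Hypotheses (mf : measurable_fun setT f) (M0 : 0 < M).
Hypothesis f_le : forall x, D x -> 0 <= f x <= M.

Definition slice (d : R) (j : nat) : set R :=
  D `&` f @^-1` `[j%:R * d, j.+1%:R * d[.

(** Lower Lebesgue sums of mesh M / n.+1. The indices below n.+1 cover values in [0, M[; the last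
    one catches the value M itself. *)
Definition slices_sum (n : nat) (h : H) : H :=
  \sum_(j < n.+2) real_complex R (j%:R * (M / n.+1%:R)) *: F (slice (M / n.+1%:R) j) h.

Let below (d : R) (j : nat) : set R := D `&` f @^-1` `]-oo, j%:R * d[.

Let b_slice d j : rborel (slice d j).
Proof.
split; last by move=> x [/bD.2].
apply: measurableI; first exact: bD.1.
by rewrite -[X in measurable X]setTI; apply: mf => //; exact: measurable_itv.
Qed.

Let b_below d j : rborel (below d j).
Proof.
split; last by move=> x [/bD.2].
apply: measurableI; first exact: bD.1.
by rewrite -[X in measurable X]setTI; apply: mf => //; exact: measurable_itv.
Qed.

Let intf_sub (mu : {measure set R -> \bar R}) h B : qmeasure ip F h mu ->
  rborel B -> B `<=` D -> mu.-integrable B (EFin \o f).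
Proof.
move=> q bB BD; apply: measurable_bounded_integrable; first exact: bB.1.
- by rewrite (qmeasureE q bB) ltry.
- exact: measurable_funTS.
- exists M; split; first exact: num_real.
  move=> K MK x Bx; have /andP[f0 fM] := f_le (BD _ Bx).
  by rewrite /= ger0_norm// (le_trans fM)// ltW.
Qed.

Lemma slices_sum_lin n (a : R[i]) u v :
  slices_sum n (a *: u + v) = a *: slices_sum n u + slices_sum n v.
Proof.
rewrite /slices_sum scaler_sumr -big_split/=; apply: eq_bigr => j _.
by rewrite (povm_lin povmF)// scalerDr !scalerA mulrC.
Qed.

Lemma slices_sum_rip n u v : rip (slices_sum n u) v =
  \sum_(j < n.+2) j%:R * (M / n.+1%:R) * rip (F (slice (M / n.+1%:R) j) u) v.
Proof.
by rewrite (psd_suml rp); apply: eq_bigr => j _; rewrite (psdZl rp).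
Qed.

Lemma slices_sum_sym n u v : rip (slices_sum n u) v = rip u (slices_sum n v).
Proof.
rewrite [RHS](psdC rp) !slices_sum_rip; apply: eq_bigr => j _.
by rewrite (povm_sym ipP povmF)// (psdC rp).
Qed.

Lemma slices_sum_im n h : rip (slices_sum n h) ('i%C *: h) = 0.
Proof.
rewrite slices_sum_rip big1// => j _.
by rewrite (rip_Im ipP) (povm_im povmF) ?mulr0.
Qed.

(** On each slice [f] exceeds its lower level by at most the mesh. The induction adds slices one at
    a time through the sublevel sets [below]. *)
Lemma slices_integral n h (mu : {measure set R -> \bar R}) : qmeasure ip F h mu ->
  rip (slices_sum n h) h <= \int[mu]_(x in D) f x <=
    rip (slices_sum n h) h + M / n.+1%:R * pm ip F D h.
Proof.
move=> q; set d := M / n.+1%:R; have d0 : 0 < d by rewrite divr_gt0.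
have below_sub j : below d j `<=` D by move=> x [].
have slice_sub j : slice d j `<=` D by move=> x [].
have key j : \sum_(i < j) i%:R * d * pm ip F (slice d i) h
    <= \int[mu]_(x in below d j) f x <=
    \sum_(i < j) i%:R * d * pm ip F (slice d i) h + d * pm ip F (below d j) h.
  elim: j => [|j /andP[IH1 IH2]].
    have -> : below d 0 = set0.
      rewrite -subset0 => x [Dx]; rewrite /= in_itv/= mul0r => fx.
      by have /andP[] := f_le Dx; rewrite leNgt fx.
    by rewrite Rintegral_set0 big_ord0 (pm0 povmF) mulr0 addr0 lexx.
  have U : below d j.+1 = below d j `|` slice d j.
    apply/seteqP; split => x; rewrite /below /slice /= !in_itv/=.
      by move=> [Dx fx]; have [?|?] := ltP (f x) (j%:R * d); [left|right].
    move=> [[Dx fx]|[Dx /andP[_ ->]]//]; split => //.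
    by rewrite (lt_le_trans fx)// ler_pM2r// ler_nat.
  have I0 : below d j `&` slice d j = set0.
    rewrite -subset0 => x [[_ +] [_ +]]; rewrite /= !in_itv/= => fx /andP[+ _].
    by rewrite leNgt fx.
  have iU : mu.-integrable (below d j `|` slice d j) (EFin \o f).
    by rewrite -U; exact: (intf_sub q).
  rewrite U Rintegral_setU//; [|exact: (b_below _ _).1|exact: (b_slice _ _).1|];
    last by apply/disj_setPS; rewrite I0.
  rewrite big_ord_recr/= (pmU povmF)//.
  have pmE : pm ip F (slice d j) h = fine (mu (slice d j)).
    by rewrite (qmeasureE q (b_slice d j)).
  have soo : (mu (slice d j) < +oo)%E by rewrite (qmeasureE q (b_slice d j)) ltry.
  have is_ := intf_sub q (b_slice d j) (slice_sub j).
  have low : j%:R * d * pm ip F (slice d j) h <= \int[mu]_(x in slice d j) f x.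
    rewrite pmE; apply: (Rintegral_ge_on (b_slice d j).1 (b_slice d j).1 (@subset_refl _ _) soo is_) => x.
      by move=> [/f_le /andP[]].
    by move=> [_]; rewrite /= in_itv/= => /andP[].
  have upp : \int[mu]_(x in slice d j) f x <= j.+1%:R * d * pm ip F (slice d j) h.
    rewrite pmE; apply: (Rintegral_le_on (b_slice d j).1 (b_slice d j).1 (@subset_refl _ _) soo is_).
      by rewrite setDv measure0.
    by move=> x [_]; rewrite /= in_itv/= => /andP[_ /ltW].
  rewrite lerD//=; apply: le_trans (lerD IH2 upp) _.
  by rewrite -natr1; lra.
have DE : below d n.+2 = D.
  apply/seteqP; split => x; first exact: below_sub.
  move=> Dx; split => //; rewrite /= in_itv/=; have /andP[_ fM] := f_le Dx.
  rewrite (le_lt_trans fM)// -[ltLHS](divfK (_ : n.+1%:R != 0 :> R))//.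
  by rewrite mulrC ltr_pM2r// ltr_nat.
by have := key n.+2; rewrite DE slices_sum_rip.
Qed.

Lemma povm_bounded : exists2 c : R, 0 < c & forall h, pm ip F Rp h <= c * rip h h.
Proof.
have [_ [c cP]] := povmF.1 Rp (rborelT R).1 (rborelT R).2.
(* The constant in [is_bop] may have any sign, hence the absolute value and the added 1. *)
exists (`|c| + 1) => [|h]; first by rewrite ltr_wpDl.
apply: le_trans (ler_norm _) _; apply: le_trans (rip_le_hnorm ipP _ _) _.
rewrite -(hnorm_sqr ipP) expr2 mulrA ler_wpM2r ?hnorm_ge0//.
apply: le_trans (cP h) _; rewrite ler_wpM2r ?hnorm_ge0//.
by rewrite (le_trans (ler_norm _))// lerDl.
Qed.

(** Both sums approximate the same integral, which bounds the quadratic form of their difference;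
    [symmetric_norm_le] upgrades this to a norm bound. *)
Let gap_le n m h (c : R) : 0 < c -> (forall h, pm ip F Rp h <= c * rip h h) ->
  hnorm ip (slices_sum n h - slices_sum m h) <=
  (M / n.+1%:R + M / m.+1%:R) * c * hnorm ip h.
Proof.
move=> c0 cP; set e := _ * c.
have dn k : 0 < M / k.+1%:R by rewrite divr_gt0.
have e0 : 0 < e by rewrite mulr_gt0// addr_gt0.
rewrite (hnorm_le ipP)//; last exact: ltW.
apply: (@symmetric_norm_le _ _ _ ipP (fun h => slices_sum n h - slices_sum m h)) => //.
- by move=> a u v; rewrite !slices_sum_lin scalerBr opprD addrACA.
- by move=> u v; rewrite !(psdDl rp, psdDr rp, psdNl rp, psdNr rp) !slices_sum_sym.
move=> u; have [mu q] := povmF.2 u.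
have /andP[n1 n2] := slices_integral n q; have /andP[m1 m2] := slices_integral m q.
have pD : pm ip F D u <= c * rip u u.
  exact: le_trans (pm_le povmF u bD (rborelT R) bD.2) (cP u).
have pD0 := pm_ge0 povmF u bD.
have hn := ler_wpM2l (ltW (dn n)) pD; have hm := ler_wpM2l (ltW (dn m)) pD.
have hn0 := mulr_ge0 (ltW (dn n)) pD0; have hm0 := mulr_ge0 (ltW (dn m)) pD0.
have -> : e * rip u u = M / n.+1%:R * (c * rip u u) + M / m.+1%:R * (c * rip u u).
  by rewrite /e; ring.
rewrite (psdDl rp) (psdNl rp) ler_norml.
move: hn hm hn0 hm0 n1 n2 m1 m2.
move: (M / _ * pm _ _ _ _) (M / _ * pm _ _ _ _) (M / _ * (c * _)) (M / _ * (c * _)).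
move: (rip _ _) (rip _ _) (\int[mu]_(x in D) f x) => A B I p q' P Q *.
by apply/andP; split; lra.
Qed.

(** By completeness the lower sums converge strongly; linearity, symmetry and the value of the form
    pass to the limit. *)
Theorem povm_integral_exists : exists S, is_opintegral ip F f S.
Proof.
have [c c0 cP] := povm_bounded.
have dn k : 0 < M / k.+1%:R by rewrite divr_gt0.
have small e : 0 < e -> exists N : nat, forall n, (N <= n)%N -> M / n.+1%:R < e.
  move=> e0; have [N Ne] := invS_lt (divr_gt0 e0 M0).
  exists N => n Nn; rewrite mulrC -ltr_pdivlMr//.
  by rewrite (le_lt_trans _ Ne)// invS_le.
have lim_ex h : exists v, forall e : R, 0 < e -> exists N : nat, forall n : nat,
    (N <= n)%N -> hnorm ip (slices_sum n h - v) < e.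
  apply: hilb.2 => e e0.
  have p0 : 0 < 2 * c * (hnorm ip h + 1).
    by rewrite mulr_gt0 ?mulr_gt0// ltr_wpDl// hnorm_ge0.
  have [N NP] := small _ (divr_gt0 e0 p0); exists N => m n Nm Nn.
  apply: le_lt_trans (gap_le m n h c0 cP) _.
  have := NP m Nm; have := NP n Nn; rewrite !ltr_pdivlMr// => h1 h2.
  have x0 := hnorm_ge0 ip h.
  have y0 := mulr_gt0 (dn m) c0; have z0 := mulr_gt0 (dn n) c0.
  by move: h1 h2 y0 z0 x0; move: (M / _) (M / _) (hnorm _ _) => p q x; nra.
pose S h := projT1 (cid (lim_ex h)).
have SP h : forall e : R, 0 < e -> exists N : nat, forall n : nat,
    (N <= n)%N -> hnorm ip (slices_sum n h - S h) < e := projT2 (cid (lim_ex h)).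
have Scvg h w : rip (slices_sum n h) w @[n --> \oo] --> rip (S h) w.
  apply/cvgrPdist_lt => e e0.
  have w0 : 0 < hnorm ip w + 1 by rewrite ltr_wpDl// hnorm_ge0.
  have [N NP] := SP h _ (divr_gt0 e0 w0); near=> n.
  rewrite distrC -(psdNl rp) -(psdDl rp).
  apply: le_lt_trans (rip_le_hnorm ipP _ _) _.
  have : hnorm ip (slices_sum n h - S h) < e / (hnorm ip w + 1).
    by apply: NP; near: n; exact: nbhs_infty_ge.
  rewrite ltr_pdivlMr// mulrDr mulr1; apply: le_lt_trans.
  by rewrite lerDl hnorm_ge0.
have S_uniq h w l : rip (slices_sum n h) w @[n --> \oo] --> l -> rip (S h) w = l.
  by move=> cl; apply: cvg_unique (Scvg h w) cl; exact: Rhausdorff.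
have Slin (a : R[i]) u v : S (a *: u + v) = a *: S u + S v.
  apply: (rip_ext ipP) => w; apply: S_uniq.
  rewrite (psdDl rp) (rip_Zl ipP).
  under eq_fun do rewrite slices_sum_lin (psdDl rp) (rip_Zl ipP).
  by apply: cvgD; exact: Scvg.
have Ssym u v : rip (S u) v = rip u (S v).
  apply: S_uniq; rewrite (psdC rp u).
  by under eq_fun do rewrite slices_sum_sym (psdC rp u); exact: Scvg.
have Sint h (mu : {measure set R -> \bar R}) : qmeasure ip F h mu ->
    rip (S h) h = \int[mu]_(x in D) f x.
  move=> q; set I := \int[mu]_(x in _) _; apply: S_uniq.
  have c1 : (I - M / n.+1%:R * pm ip F D h) @[n --> \oo] --> I - 0 * pm ip F D h.
    apply: cvgB; [exact: cvg_cst|apply: cvgM; [|exact: cvg_cst]].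
    apply/cvgrPdist_lt => e e0; have [N NP] := small _ e0; near=> n.
    rewrite sub0r normrN ger0_norm ?ltW//; apply: NP; near: n; exact: nbhs_infty_ge.
  rewrite mul0r subr0 in c1.
  apply: (squeeze_cvgr _ c1 (@cvg_cst _ I _ _ _)).
  apply: nearW => n; have /andP[n1 n2] := slices_integral n q.
  by rewrite n1 andbT lerBlDr.
have Sbd h : rip (S h) (S h) <= (M * c) ^+ 2 * rip h h.
  apply: (symmetric_norm_le ipP) => // [|u]; first exact: mulr_gt0.
  have [mu q] := povmF.2 u; rewrite (Sint u mu q).
  have Doo : (mu D < +oo)%E by rewrite (qmeasureE q bD) ltry.
  have iD := intf_sub q bD (@subset_refl _ _).
  rewrite ger0_norm; last by apply: Rintegral_ge0 => x /f_le /andP[].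
  apply: le_trans (Rintegral_le_on (c := M) bD.1 bD.1 (@subset_refl _ _) Doo iD _ _) _.
  - by rewrite setDv measure0.
  - by move=> x /f_le /andP[].
  rewrite (qmeasureE q bD)/= -mulrA ler_pM2l//.
  exact: le_trans (pm_le povmF u bD (rborelT R) bD.2) (cP u).
exists S; split; first split => //.
  by exists (M * c) => u; rewrite (hnorm_le ipP)// mulr_ge0// ltW.
move=> h mu q; have [mR _] := rborelT R.
have bN := rborelD (rborelT R) bD.
have N0 : mu (Rp `\` D) = 0%E by rewrite (qmeasureE q bN) D0.
have DDE : Rp `\` (Rp `\` D) = D by rewrite setDD setIidr//; exact: bD.2.
have mfR : measurable_fun Rp (EFin \o f).
  by apply/measurable_EFinP; exact: measurable_funTS.
have iR : mu.-integrable Rp (EFin \o f).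
  rewrite (negligible_integrable bN.1)// DDE.
  exact: intf_sub q bD (@subset_refl _ _).
split => //.
(* The approximants have real quadratic forms, and pairing with i h carries this to the limit. *)
have Im0 : complex.Im (ip (S h) h) = 0.
  rewrite -(rip_Im ipP); apply: S_uniq.
  by under eq_fun do rewrite slices_sum_im; exact: cvg_cst.
have := Sint h mu q; rewrite /Rintegral (negligible_integral bN.1 mR iR N0) DDE.
by move: Im0; rewrite /re_ip; case: (ip (S h) h) => x y /= -> ->.
Unshelve. all: by end_near. Qed.

End PovmIntegral.

(** * Set functions agreeing on the Borel subsets of R_+ *)

Section Congruence.
Variables (R : realType) (H : lmodType R[i]) (ip : H -> H -> R[i]).
Variables E F : set R -> H -> H.
Hypothesis EF : forall A h, rborel A -> F A h = E A h.

Lemma qmeasure_congr h (mu : {measure set R -> \bar R}) :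
  qmeasure ip F h mu -> qmeasure ip E h mu.
Proof. by move=> q A mA sA; rewrite -EF//; exact: q. Qed.

Lemma opintegral_congr f S : is_opintegral ip E f S -> is_opintegral ip F f S.
Proof. by move=> [bS iS]; split => // h mu /qmeasure_congr; exact: iS. Qed.

Lemma spectral_measure_congr T :
  is_povm ip F -> spectral_measure_of ip T E -> spectral_measure_of ip T F.
Proof.
move=> povmF [[_ projE ET] intE]; split; last exact: opintegral_congr.
split => // [A mA sA|h]; last by rewrite EF//; exact: rborelT.
by have [? ?] := projE A mA sA; split => *; rewrite !EF.
Qed.

End Congruence.

(** * Powers of [T] and the equivalence *)

Section Powers.
Variables (R : realType) (H : lmodType R[i]) (ip : H -> H -> R[i]).
Variables (T : H -> H) (F : set R -> H -> H).
Hypotheses (hilb : is_hilbert ip) (povmF : is_povm ip F).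
Local Notation Rp := (@Rplus R).

Lemma compact_support_powR (p : R) : compact_support F -> 0 <= p ->
  exists S, is_opintegral ip F (fun x => x `^ p) S.
Proof.
move=> [K [cK KR K0]] p0; have [B [_ KB]] := compact_bounded cK.
(* The bound on [K] is available only for numbers strictly above [B]. *)
pose b := `|B| + 1; have Bb : B < b by rewrite (le_lt_trans (ler_norm _))// ltrDl.
have b0 : 0 <= b by rewrite addr_ge0.
have bD : rborel (`[0, b]%classic : set R) by apply: rborel_itv; rewrite bnd_simp.
have bK : rborel (Rp `\` K).
  by apply: rborelD; [exact: rborelT|split => //; exact: compact_measurable].
apply: (povm_integral_exists hilb povmF (D := `[0, b]%classic) (M := b `^ p + 1)) => //.
- move=> h; have bN := rborelD (rborelT R) bD.
  apply/le_anti; rewrite (pm_ge0 povmF)// andbT.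
  have s : Rp `\` `[0, b]%classic `<=` Rp `\` K.
    move=> x [Rx nx]; split => // Kx; apply: nx.
    move: Rx; rewrite /Rplus /= !in_itv/= andbT => x0; rewrite x0/=.
    by rewrite (le_trans (ler_norm _))//; exact: KB.
  apply: le_trans (pm_le povmF h bN bK s) _.
  by rewrite /pm K0 (psd0l (rip_psd hilb.1)).
- by rewrite ltr_wpDl// powR_ge0.
- move=> x /=; rewrite in_itv/= => /andP[x0 xb]; rewrite powR_ge0/=.
  by rewrite (@le_trans _ _ (b `^ p))// ?lerDl// ge0_ler_powR// nnegrE.
Qed.

(** A power of [T] is an integral against some spectral measure of [T], and here [F] itself is
    one. *)
Lemma spectral_oppow (p : R) : spectral_measure_of ip T F -> compact_support F ->
  0 <= p ->
  exists S, is_oppow ip T p S /\ is_opintegral ip F (fun x => x `^ p) S.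
Proof.
move=> specF csF p0; have [S iS] := compact_support_powR csF p0.
by exists S; split => //; exists F.
Qed.

Hypothesis linT : forall (a : R[i]) (u v : H), T (a *: u + v) = a *: T u + T v.
Hypotheses (posT : positive_op ip T) (injT : injective T).

Lemma spectral_of_two_powers (al be : R) (Sa Sb : H -> H) : 0 < al -> al < be ->
  is_oppow ip T al Sa -> is_opintegral ip F (fun x => x `^ al) Sa ->
  is_oppow ip T be Sb -> is_opintegral ip F (fun x => x `^ be) Sb ->
  (forall h, ip (F Rp h) h <= ip h h) -> spectral_measure_of ip T F.
Proof.
move=> al0 albe [E [specE aE]] aF [E' [specE' bE']] bF F1.
(* Each power comes with its own spectral measure; uniqueness transfers the second one to [E]. *)
have EE' := spectral_measure_unique hilb.1 linT posT specE' specE.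
have bE := opintegral_congr EE' bE'.
have F_le1 h : pm ip F Rp h <= re_ip ip h h by have := F1 h; rewrite lecE => /andP[].
have E0 h := spectral_zero hilb.1 linT posT specE h injT.
apply: (spectral_measure_congr _ povmF specE) => A h.
exact: (povm_eq_of_two_moments hilb.1 al0 albe specE.1 povmF aE bE aF bF F_le1 E0).
Qed.

End Powers.

Theorem theorem3p1 (R : realType) (H : lmodType R[i]) (ip : H -> H -> R[i])
    (T : H -> H) (alpha beta : R) (F : set R -> H -> H) :
  is_hilbert ip ->
  is_bop ip T -> positive_op ip T -> injective T ->
  0 < alpha -> 0 < beta -> alpha != beta ->
  is_povm ip F -> compact_support F ->
  (spectral_measure_of ip T F <->
   ((exists S : H -> H, is_oppow ip T alpha S /\
                        is_opintegral ip F (fun x => x `^ alpha) S) /\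
    (exists S : H -> H, is_oppow ip T beta S /\
                        is_opintegral ip F (fun x => x `^ beta) S) /\
    (forall h : H, ip (F (@Rplus R) h) h <= ip h h))).
Proof.
move=> hilb [linT _] posT injT a0 b0 ab povmF csF; split.
  move=> specF; split; first exact: (spectral_oppow hilb povmF specF csF (ltW a0)).
  split; first exact: (spectral_oppow hilb povmF specF csF (ltW b0)).
  by move=> h; rewrite (pvmT specF.1).
move=> [[Sa [Ta aF]] [[Sb [Tb bF]] F1]].
move: ab; rewrite neq_lt => /orP[ab|ba].
  exact: (spectral_of_two_powers hilb povmF linT posT injT a0 ab Ta aF Tb bF F1).
exact: (spectral_of_two_powers hilb povmF linT posT injT b0 ba Tb bF Ta aF F1).
Qed.
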